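(* Let $\pi$ be a set of primes, let $G$ be a finite $\pi$-separable group, and let $\varphi \in \mathrm{I}_{\pi}(G)$. Let $L_{\varphi} = \{ \chi \in \mathrm{Irr}(G) \mid \chi^0 = \varphi \}$. Then there is a subgroup $W_{\varphi}$ of $G$ and an irreducible $\pi$-partial character $\alpha \in \mathrm{I}_{\pi}(W_{\varphi})$ such that $|L_{\varphi}| \geq |W_{\varphi} : W_{\varphi}'|_{\pi'}$, $\alpha^G = \varphi$, and $\alpha(1)$ is a $\pi$-number.
   Context: $\pi'$ denotes the complement of $\pi$ in the set of all primes; a positive integer is a $\pi$-number if all its prime divisors lie in $\pi$, and $n_{\pi'}$ denotes the $\pi'$-part of $n$ (the largest divisor of $n$ that is a $\pi'$-number). A finite group is $\pi$-separable if it has a normal series each of whose factors is a $\pi$-group or a $\pi'$-group; subgroups of $\pi$-separable groups are $\pi$-separable. $W'$ denotes the commutator subgroup of $W$. $\mathrm{Irr}(G)$ is the set of irreducible complex characters of $G$. For a class function $\chi$ of a group $H$, $\chi^0$ denotes its restriction to the set of $\pi$-elements of $H$ (elements whose order is a $\pi$-number). For $\pi$-separable $H$, a $\pi$-partial character of $H$ is a function of the form $\chi^0$ with $\chi$ an ordinary (complex) character of $H$; it is irreducible if it is not a sum of two $\pi$-partial characters. $\mathrm{I}_{\pi}(H)$ is the set of irreducible $\pi$-partial characters of $H$. If $H \le G$ and $\alpha = \psi^0$ is a $\pi$-partial character of $H$ with $\psi$ a character of $H$, the induced $\pi$-partial character is $\alpha^G = (\psi^G)^0$ (equivalently, given by the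 usual induction formula on $\pi$-elements; it depends only on $\alpha$). *)

(* Defs.v *)
From HB Require Import structures.
From mathcomp Require Import all_boot all_order all_fingroup all_algebra.
From mathcomp Require Import all_solvable all_field all_character.

Set Implicit Arguments.
Unset Strict Implicit.
Unset Printing Implicit Defensive.

Import GroupScope GRing.Theory.
Local Open Scope ring_scope.

Section PiSeparable.

Variables (gT : finGroupType) (pi : nat_pred).

Definition pi_factor (G H K : {set gT}) : bool :=
  [&& H <| G, K <| G, H \subset K
    & pi.-group (K / H)%g || pi^'.-group (K / H)%g].

Definition pi_separable (G : {group gT}) : Prop :=
  exists2 s : seq {group gT}, (pi_factor G).-series 1%G s & last 1%G s = G.

End PiSeparable.

Section PiPartial.

Variables (gT : finGroupType) (pi : nat_pred).
Implicit Types G H : {group gT}.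

Definition pi_elts G : {set gT} := [set x in G | pi.-elt x].

Fact pi_elts_normal G : pi_elts G <| G.
Proof.
apply/andP; split; first by apply/subsetP=> x; rewrite inE => /andP[].
apply/subsetP=> y Gy; rewrite inE; apply/subsetP=> _ /imsetP[x + ->].
by rewrite !inE p_eltJ groupJr.
Qed.

(* A function on the pi-elements of G is encoded as its extension by 0 to     *)
(* the whole of G. This is injective and compatible with sums, so equalities  *)
(* in 'CF(G) between such functions are equalities on pi-elements.            *)
Definition pi_restr G (chi : 'CF(G)) : 'CF(G) := chi * '1_(pi_elts G).

Lemma pi_restrE G (chi : 'CF(G)) x :
  pi_restr chi x = if pi.-elt x then chi x else 0.
Proof.
rewrite /pi_restr cfunE cfuniE ?pi_elts_normal // inE.
have [Gx | notGx] := boolP (x \in G); last by rewrite cfun0 // mul0r if_same.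
by case: ifP => _; rewrite ?mulr1 ?mulr0.
Qed.

(* The library's character predicate also holds of 0, hence chi != 0.         *)
Definition pi_partial_char G (phi : 'CF(G)) : Prop :=
  exists2 chi : 'CF(G), (chi \is a character) && (chi != 0)
                      & phi = pi_restr chi.

Definition pi_partial_irr G (phi : 'CF(G)) : Prop :=
  pi_partial_char phi
  /\ ~ (exists alpha beta : 'CF(G),
          [/\ pi_partial_char alpha, pi_partial_char beta
            & phi = alpha + beta]).

(* With the extension by 0, the usual induction formula on pi-elements is     *)
(* plain induction of class functions, and pi_Ind_restr is the equation       *)
(* (psi^0)^G = (psi^G)^0.                                                     *)
Definition pi_Ind G H (alpha : 'CF(H)) : 'CF(G) := 'Ind[G] alpha.

Lemma pi_Ind_restr G H (psi : 'CF(H)) : H \subset G ->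
  pi_Ind G (pi_restr psi) = pi_restr ('Ind[G] psi).
Proof.
move=> sHG; apply/cfunP=> x; rewrite pi_restrE !cfIndE //.
have [pi_x | pi'x] := boolP (pi.-elt x).
  by congr (_ * _); apply: eq_bigr => y _; rewrite pi_restrE p_eltJ pi_x.
rewrite big1 ?mulr0 // => y _.
by rewrite pi_restrE p_eltJ (negPf pi'x).
Qed.

Definition lifts G (phi : 'CF(G)) : {set Iirr G} :=
  [set i | pi_restr 'chi_i == phi].

End PiPartial.

Arguments pi_Ind {gT} G {H} alpha.

(* Main.v *)
Require Import Defs.
From HB Require Import structures.
From mathcomp Require Import all_boot all_order all_fingroup all_algebra.
From mathcomp Require Import all_solvable all_field all_character.

(* Climb a normal series of G with pi- and pi'-factors, keeping a G-invariant *)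
(* irreducible character nu of the current term N below a lift of phi. Across *)
(* a pi'-factor X / N, nu has a canonical extension to X, and phi also has a  *)
(* lift over it. Across a pi-factor M / N, Clifford theory replaces G by the  *)
(* inertia group of a character mu of M over nu. When N exhausts the group W  *)
(* reached so far, nu = gamma has pi-degree and alpha = gamma^0 induces to    *)
(* phi. The climb also keeps the property that phi_W is not 2 alpha plus a    *)
(* pi-partial character, so that, for delta a linear character of W of        *)
(* pi'-order, the lifts (gamma delta)^G of phi are pairwise distinct.         *)

(** The bound comes from twisting. A linear character [delta] of [W] of pi'-order is 1 on
    pi-elements, so every (gamma delta)^G is a lift of [phi], and there are |W : W'|_{pi'} such
    [delta]. The products gamma delta are distinct because [gamma] has pi-degree ([lin_twist_inj]).
    If two of them induced the same character, Frobenius reciprocity would put both into its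
    restriction to [W], making phi_W equal to twice gamma^0 plus the restriction of a character; the
    last clause of [pi_partial_inducing_pair] forbids this.

    That lemma performs the climb, with [pi_controlled] as invariant. Being controlled forces
    pi-degree, so across a pi'-factor coprimeness yields one extension of pi-order
    ([coprime_irr_extendible]), invariant by uniqueness, and [pi_restr_over_extension] moves the
    lift above it. Across a pi-factor, Hall pi-subgroups supplement [N], and restriction to a
    supplement is isometric on characters over [nu] ([lies_over_isometry]). Hence pi-elements see
    the part of a character over [mu] ([pi_restr_isotypic]), and the multiplicity property survives
    the passage to the inertia group. *)

Set Implicit Arguments.
Unset Strict Implicit.
Unset Printing Implicit Defensive.

Import GroupScope Order.TTheory GRing.Theory Num.Theory.
Local Open Scope ring_scope.

(** * Extending an invariant irreducible representation *)

Section ProjectiveExtension.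

Variables (gT : finGroupType) (N G : {group gT}) (n : nat).
Variables (rN : mx_representation algC N n) (omega : 'CF(G)).
Hypotheses (nsNG : N <| G) (irrN : mx_irreducible rN).
Hypotheses (lin_omega : omega \is a linear_char).
Hypothesis inv_rN : G \subset 'I[cfRepr rN].
Hypothesis det_rN : {in N, forall x, \det (rN x) = omega x}.
Hypothesis co_iGN : coprime #|G : N| n.

Let sNG : N \subset G := normal_sub nsNG.
Let n_gt0 : (0 < n)%N. Proof. by case/mx_irrP: irrN. Qed.
Let nNG g x : g \in G -> x \in N -> (x ^ g)%g \in N.
Proof. by move=> Gg Nx; rewrite memJ_norm // (subsetP (normal_norm nsNG)). Qed.

(** By invariance [rN] and its conjugate by [g] afford the same character, so they are similar; an
    n-th root rescales the intertwiner to the prescribed determinant. *)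
Lemma mx_repr_conj_intertwiner g : g \in G ->
  exists B : 'M_n, {in N, forall x, rN x *m B = B *m rN (x ^ g)%g}
                /\ \det B = omega g.
Proof.
move=> Gg; have rJ: mx_repr N (fun x => rN (x ^ g)%g).
  split=> [|x y Nx Ny]; first by rewrite conj1g repr_mx1.
  by rewrite conjMg repr_mxM ?nNG.
have /cfRepr_inj[B _ freeB homB]: cfRepr rN = cfRepr (MxRepresentation rJ).
  apply/cfun_inP=> x Nx; rewrite -(inertia_valJ _ (subsetP inv_rN g Gg)).
  by rewrite !cfunE nNG ?Nx.
have unitB: \det B != 0 by rewrite -unitfE -unitmxE -row_free_unit.
exists ((n.-root (omega g / \det B)) *: B); split=> [x Nx|].
  by rewrite -scalemxAr homB // scalemxAl.
by rewrite detZ rootCK // divfK.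
Qed.

Lemma projective_extension :
  exists P : gT -> 'M_n,
    [/\ {in N & G, forall x g, rN x *m P g = P g *m rN (x ^ g)%g},
        {in N & G, forall x g, P (x * g)%g = rN x *m P g}
      & {in G, forall g, \det (P g) = omega g}].
Proof.
have: forall g, exists B : 'M_n, g \in G ->
    {in N, forall x, rN x *m B = B *m rN (x ^ g)%g} /\ \det B = omega g.
  move=> g; have [/mx_repr_conj_intertwiner[B ?]|_] := boolP (g \in G).
    by exists B.
  by exists 0.
(* Intertwiners are kept only at coset representatives and spread over each coset by [rN], which
   will make the cocycle constant on cosets of [N]. *)
move=> /fin_all_exists[P0 P0P]; pose r g := repr (N :* g).
have rP g: g \in G -> r g \in G /\ (g * (r g)^-1)%g \in N.
  move=> Gg; have: r g \in N :* g by apply: mem_repr_rcoset.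
  case/rcosetP=> x Nx ->; rewrite groupM ?(subsetP sNG x) //; split=> //.
  by rewrite invMg mulKVg groupV.
exists (fun g => rN (g * (r g)^-1)%g *m P0 (r g)); split.
- move=> x g Nx Gg; have [Grg Ng] := rP g Gg; have [homP _] := P0P _ Grg.
  have Ggr: (g * (r g)^-1)%g \in G by rewrite (subsetP sNG).
  rewrite !mulmxA -repr_mxM // conjgC repr_mxM ?(nNG Ggr) // -!mulmxA.
  by rewrite homP ?(nNG Ggr) // -conjgM mulgKV.
- move=> x g Nx Gg; have [Grg Ng] := rP g Gg.
  have ->: r (x * g)%g = r g by rewrite /r rcosetM rcoset_id.
  by rewrite -mulgA repr_mxM ?mulmxA.
move=> g Gg; have [Grg Ng] := rP g Gg; have [_ detP] := P0P _ Grg.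
by rewrite det_mulmx det_rN // detP -(lin_charM lin_omega) ?(subsetP sNG _ Ng)
  ?mulgKV.
Qed.

(* Determinants make the cocycle f of the projective extension n-torsion, and *)
(* multiplying the cocycle identity over G / N makes it |G : N|-torsion up to *)
(* the coboundary of v. As the two exponents are coprime, f is a coboundary.  *)
Lemma mx_repr_extendible :
  exists rG : mx_representation algC G n, {in N, forall x, rG x = rN x}.
Proof.
have [P [homP PM detP]] := projective_extension.
have unitP g: g \in G -> P g \in unitmx.
  by move=> Gg; rewrite unitmxE detP // unitfE lin_char_neq0.
have scaleI g a b: g \in G -> a *: P g = b *: P g -> a = b.
  move=> Gg /(congr1 (mulmx^~ (invmx (P g)))).
  rewrite -!scalemxAl !mulmxV ?unitP // !scalemx1.
  by move/matrixP/(_ (Ordinal n_gt0) (Ordinal n_gt0)); rewrite !mxE eqxx.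
have: forall gh : gT * gT, exists c, gh.1 \in G -> gh.2 \in G ->
    P gh.1 *m P gh.2 = c *: P (gh.1 * gh.2)%g.
  case=> g h /=; have [Gg | _] := boolP (g \in G); last by exists 0.
  have [Gh | _] := boolP (h \in G); last by exists 0.
  have Ggh := groupM Gg Gh.
  pose A := P g *m P h *m invmx (P (g * h)%g).
  suff /is_scalar_mxP[c Ac]: is_scalar_mx A.
    by exists c => _ _; rewrite -mul_scalar_mx -Ac mulmxKV ?unitP.
  apply: (mx_abs_irr_cent_scalar (groupC irrN)); apply/centgmxP=> x Nx.
  rewrite /A -!mulmxA.
  have xgh : P (g * h)%g *m rN (x ^ (g * h))%g = rN x *m P (g * h)%g.
    by rewrite homP.
  have ->: invmx (P (g * h)%g) *m rN x
         = rN (x ^ (g * h))%g *m invmx (P (g * h)%g).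
    apply: (canRL (mulmxK (unitP _ Ggh))).
    by rewrite -mulmxA -xgh mulKmx ?unitP.
  rewrite conjgM !mulmxA -(mulmxA (P g)) -homP ?(nNG Gg) // mulmxA.
  by rewrite -homP.
move=> /fin_all_exists[f0 f0P]; pose f g h := f0 (g, h).
have fP g h: g \in G -> h \in G -> P g *m P h = f g h *: P (g * h)%g.
  by move=> Gg Gh; apply: (f0P (g, h)).
have f_expn g h: g \in G -> h \in G -> f g h ^+ n = 1.
  move=> Gg Gh; have /(congr1 determinant) := fP g h Gg Gh.
  rewrite det_mulmx detZ !detP ?groupM // -(lin_charM lin_omega) //.
  move/eqP; rewrite -subr_eq0 -{1}[omega _]mul1r -mulrBl mulf_eq0.
  by rewrite (negPf (lin_char_neq0 _ _)) ?groupM // orbF subr_eq0 => /eqP.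
have f_neq0 g h: g \in G -> h \in G -> f g h != 0.
  move=> Gg Gh; apply/eqP=> f0gh; have /eqP := f_expn g h Gg Gh.
  by rewrite f0gh expr0n gtn_eqF // eq_sym oner_eq0.
have f_Nl x g h: x \in N -> g \in G -> h \in G -> f (x * g)%g h = f g h.
  move=> Nx Gg Gh; have Gx := subsetP sNG x Nx.
  apply: (scaleI (x * g * h)%g); rewrite ?groupM // -fP ?groupM //.
  by rewrite PM // -mulmxA fP // -mulgA (PM x) ?groupM // scalemxAr.
have f_Nr x g h: x \in N -> g \in G -> h \in G -> f g (x * h)%g = f g h.
  move=> Nx Gg Gh; have Gx := subsetP sNG x Nx.
  have Nx' : (x ^ g^-1)%g \in N by rewrite nNG ?groupV.
  apply: (scaleI (g * (x * h))%g); rewrite ?groupM // -fP ?groupM //.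
  rewrite PM // mulmxA -{1}[x](conjgKV g) -homP // -mulmxA fP // -scalemxAr.
  by rewrite -(PM _ _ Nx') ?groupM // !mulgA -conjgCV.
have f_cocycle g h k: g \in G -> h \in G -> k \in G ->
    f g h * f (g * h)%g k = f h k * f g (h * k)%g.
  move=> Gg Gh Gk; apply: (scaleI (g * h * k)%g); rewrite ?groupM //.
  rewrite -scalerA -fP ?groupM // scalemxAl -fP // -mulmxA fP // -scalemxAr.
  by rewrite fP ?groupM // scalerA mulgA.
have GN_repr (K : coset_of N) : K \in (G / N)%g -> repr K \in G.
  case/morphimP=> x _ Gx ->; rewrite val_coset ?(subsetP (normal_norm nsNG)) //.
  have: repr (N :* x) \in N :* x by apply: mem_repr_rcoset.
  by case/rcosetP=> y Ny ->; rewrite groupM ?(subsetP sNG y).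
pose v g := \prod_(K in (G / N)%g) f g (repr K).
have vP g h: g \in G -> h \in G -> f g h ^+ #|G : N| * v (g * h)%g = v g * v h.
  move=> Gg Gh; have nNh := subsetP (normal_norm nsNG) h Gh.
  (* Translation by [coset N h] permutes the cosets, so the cocycle identity can be multiplied out
     over the representatives of [K]. *)
  have ->: v g = \prod_(K in (G / N)%g) f g (h * repr K)%g.
    rewrite /v (reindex_inj (mulgI (coset N h))) /=.
    apply: eq_big => [K | K GK]; first by rewrite groupMl ?mem_quotient.
    rewrite groupMl ?mem_quotient // in GK.
    have Gk := GN_repr K GK; have nNk := subsetP (normal_norm nsNG) _ Gk.
    have: repr (coset N h * K)%g \in N :* (h * repr K)%g.
      have E: coset N (h * repr K)%g = (coset N h * K)%g.
        by rewrite morphM //; congr (_ * _)%g; apply: coset_reprK.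
      by rewrite -val_coset ?groupM // E mem_repr_coset.
    by case/rcosetP=> y Ny ->; rewrite f_Nr ?groupM.
  rewrite mulrC [RHS]mulrC.
  have <-: \prod_(K in (G / N)%g) f g h = f g h ^+ #|G : N|.
    by rewrite prodr_const card_quotient ?normal_norm.
  rewrite /v -!big_split; apply: eq_bigr => K /GN_repr Gk /=.
  by rewrite mulrC f_cocycle.
have v_neq0 g: g \in G -> v g != 0.
  by move=> Gg; apply/prodf_neq0 => K /GN_repr Gk; apply: f_neq0.
(* With [b] inverse to the index modulo [n], the b-th power of [vP] has [f g h] itself on the left,
   since its n-th power is 1. *)
have [b bmP]: exists b, b * #|G : N| = 1 %[mod n].
  have co_n_iGN: coprime n #|G : N| by rewrite coprime_sym.
  rewrite -(chinese_modl co_n_iGN 1 0) /chinese !mul0n addn0 !mul1n mulnC.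
  by exists (egcdn #|G : N| n).1.
pose c g := v g ^+ b.
have cP g h: g \in G -> h \in G -> f g h * c (g * h)%g = c g * c h.
  move=> Gg Gh; rewrite /c -exprMn -vP // exprMn -exprM mulnC.
  by rewrite -(expr_mod _ (f_expn g h Gg Gh)) bmP expr_mod ?f_expn ?expr1.
pose Q g := (c g)^-1 *: P g.
have QM: {in G &, {morph Q : g h / (g * h)%g >-> g *m h}}.
  move=> g h Gg Gh; rewrite /Q -scalemxAl -scalemxAr fP // !scalerA.
  congr (_ *: _); rewrite -[_^-1 / _]invfM -cP // invfM mulrAC mulVf ?mul1r //.
  exact: f_neq0.
have c_neq0 g: g \in G -> c g != 0 by move=> Gg; rewrite expf_neq0 ?v_neq0.
have Q1: Q 1%g = 1%:M.
  have unitQ1: Q 1%g \in unitmx.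
    by rewrite unitmxZ ?unitP // unitfE invr_neq0 ?c_neq0.
  by apply: (can_inj (mulKmx unitQ1)); rewrite -QM ?mulg1 ?mulmx1.
have rQ : mx_repr G Q by [].
exists (MxRepresentation rQ) => x Nx /=; have Gx := subsetP sNG x Nx.
rewrite -[x]mulg1 /Q PM // mulg1 scalemxAr.
have ->: c x = c 1%g.
  rewrite /c /v -{1}[x]mulg1; congr (_ ^+ _); apply: eq_bigr => K /GN_repr Gk.
  by rewrite f_Nl.
by rewrite -/(Q 1%g) Q1 mulmx1.
Qed.

End ProjectiveExtension.

Lemma irr_extendible_from_det (gT : finGroupType) (N G : {group gT}) s u :
  N <| G -> G \subset 'I['chi[N]_s] ->
  coprime #|G : N| (Num.truncn ('chi_s 1%g)) ->
  'Res[N, G] 'chi_u = cfDet 'chi_s -> exists c, 'Res[N, G] 'chi_c = 'chi_s.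
Proof.
move=> nsNG IGs; have sNG := normal_sub nsNG.
have /irr_reprP[[n rN] /= irrN Ds] := mem_irr s.
rewrite Ds cfRepr1 natrK cfDetRepr => co_iGN Du.
have lin_u: 'chi_u \is a linear_char.
  rewrite qualifE /= irr_char -(cfRes1 N) Du.
  exact/eqP/lin_char1/detRepr_lin_char.
have detN: {in N, forall x, \det (rN x) = 'chi_u x}.
  move=> x Nx; rewrite -(cfResE _ sNG Nx) Du cfunE Nx mulr1n.
  by rewrite trace_mx11 mxE.
rewrite Ds in IGs.
have [rG rGP] := mx_repr_extendible nsNG irrN lin_u IGs detN co_iGN.
have resG: 'Res[N] (cfRepr rG) = cfRepr rN.
  by apply/cfun_inP=> x Nx; rewrite cfResE // !cfunE Nx (subsetP sNG) ?rGP.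
have /irrP[c Dc]: cfRepr rG \in irr G.
  apply: (cfRes_irr_irr (H := N)); first exact: cfRepr_char.
  by rewrite resG -Ds mem_irr.
by exists c; rewrite -Dc.
Qed.

Lemma index_mulG (gT : finGroupType) (A B G : {group gT}) :
  (A * B)%g = G -> #|G : A| = #|B : A :&: B|.
Proof.
move=> defG; have sAG: A \subset G by rewrite -defG mulG_subl.
apply/eqP; rewrite -(eqn_pmul2l (cardG_gt0 A)) Lagrange //.
rewrite -(eqn_pmul2r (cardG_gt0 (A :&: B))) -mulnA [X in _ == (_ * X)%N]mulnC.
by rewrite Lagrange ?subsetIr // -defG mul_cardG.
Qed.

(** The determinant extends first, uniquely with order coprime to the index; then
    [irr_extendible_from_det] extends ['chi_s]. Exactly one extension has the chosen determinant,
    and coprime order forces that determinant. *)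
Lemma coprime_irr_extendible (gT : finGroupType) (N G : {group gT}) s :
    N <| G -> G \subset 'I['chi[N]_s] ->
    coprime #|G : N| (Num.truncn ('chi_s 1%g)) ->
    coprime #|G : N| 'o('chi_s)%CF ->
  exists c, [/\ 'Res[N, G] 'chi_c = 'chi_s, 'o('chi_c)%CF = 'o('chi_s)%CF
              & forall d, 'Res[N, G] 'chi_d = 'chi_s ->
                  coprime #|G : N| 'o('chi_d)%CF -> d = c].
Proof.
move=> nsNG IGs co1 coo; have sNG := normal_sub nsNG.
have lin_det := cfDet_lin_char 'chi_s.
have IGdet: G \subset 'I[cfDet 'chi_s].
  apply/subsetP=> x /(subsetP IGs); rewrite !inE => /andP[-> /eqP sx].
  by rewrite -cfDetConjg sx eqxx.
have [|u [Du ou uniq_u]] := extend_coprime_linear_char nsNG lin_det IGdet.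
  by rewrite cfDet_order_lin.
have [c0 Dc0] := irr_extendible_from_det nsNG IGs co1 Du.
have [c [Dc detc] uniq_c] := extend_to_cfdet nsNG co1 Dc0 Du.
exists c; split=> // [|d Dd cod].
  have lin_u: 'chi_u \is a linear_char by rewrite -detc cfDet_lin_char.
  by rewrite /cfDet_order detc -!cfDet_order_lin.
apply: uniq_c => //; have /irrP[v Dv] := lin_char_irr (cfDet_lin_char 'chi_d).
rewrite Dv; congr 'chi_ _; apply: uniq_u; rewrite -Dv.
  by rewrite -cfDetRes ?irr_char ?Dd.
by rewrite cfDet_order_lin ?cfDet_lin_char.
Qed.

(** * Characters over an invariant character *)

Section LyingOver.

Variables (gT : finGroupType).
Implicit Types N G L : {group gT}.

(* Meant for G-invariant irreducible nu, where Clifford's theorem gives this  *)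
(* form. The zero character lies over every nu.                               *)
Definition lies_over N G (nu : 'CF(N)) (chi : 'CF(G)) :=
  exists c, 'Res[N] chi = c *: nu.

Lemma char_mul_irr N (phi : 'CF(N)) s :
    phi \is a character -> (forall k, k \in irr_constt phi -> k = s) ->
  phi = '[phi, 'chi_s] *: 'chi_s.
Proof.
move=> Nphi phi_s; rewrite [phi in LHS]cfun_sum_constt big_mkcond.
rewrite (bigD1 s) //= big1 ?addr0 => [|k ks].
  by rewrite irr_consttE; case: eqP => //= ->; rewrite scale0r.
by case: ifP => // /phi_s ks'; rewrite ks' eqxx in ks.
Qed.

Lemma constt_char_add N (phi psi : 'CF(N)) k :
    phi \is a character -> psi \is a character ->
  k \in irr_constt phi -> k \in irr_constt (phi + psi).
Proof.
move=> Nphi Npsi; rewrite !irr_consttE cfdotDl => phik.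
by rewrite paddr_eq0 ?natr_ge0 ?Cnat_cfdot_char_irr // negb_and phik.
Qed.

Lemma lies_over_addl N G s (phi psi : 'CF(G)) :
    phi \is a character -> psi \is a character ->
  lies_over 'chi[N]_s (phi + psi) -> lies_over 'chi_s phi.
Proof.
move=> Nphi Npsi [c]; rewrite linearD /= => Dc.
exists ('['Res[N] phi, 'chi_s]); apply: char_mul_irr; rewrite ?cfRes_char //.
move=> k phik; have: k \in irr_constt ('Res[N] phi + 'Res[N] psi).
  by rewrite constt_char_add ?cfRes_char.
rewrite Dc irr_consttE cfdotZl cfdot_irr; have [-> // | _] := eqVneq s k.
by rewrite mulr0 eqxx.
Qed.


Lemma lies_over_constt N G s (chi : 'CF(G)) i :
    chi \is a character -> lies_over 'chi[N]_s chi -> i \in irr_constt chi ->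
  lies_over 'chi_s 'chi_i.
Proof.
move=> Nchi over_chi /constt_charP[//|chi' Nchi' Dchi].
by apply: (@lies_over_addl _ _ _ _ chi'); rewrite ?irr_char // -Dchi.
Qed.

Lemma lies_over_irr_constt N G s i :
  lies_over 'chi[N]_s 'chi[G]_i -> s \in irr_constt ('Res[N] 'chi_i).
Proof.
case=> c Dc; have: 'Res[N] 'chi_i != 0 by rewrite Res_irr_neq0.
rewrite Dc irr_consttE cfdotZl cfnorm_irr mulr1.
by apply: contraNneq => ->; rewrite scale0r.
Qed.

Lemma lies_over_inv N G s i :
    N <| G -> G \subset 'I['chi[N]_s] -> s \in irr_constt ('Res[N] 'chi[G]_i) ->
  lies_over 'chi_s 'chi_i.
Proof.
move=> nsNG IGs si; exists ('['Res[N] 'chi_i, 'chi_s]).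
by rewrite {1}(Clifford_Res_sum_cfclass nsNG si) cfclass_invariant // big_seq1.
Qed.

End LyingOver.

(** * Restriction to a supplement of a normal subgroup *)

Section Supplement.

Variables (gT : finGroupType) (N G L Y : {group gT}) (s : Iirr N).
Hypotheses (nsNG : N <| G) (sLG : L \subset G).
Hypotheses (defG : (N * L)%g = G) (defY : N :&: L = Y).
Hypotheses (IGs : G \subset 'I['chi_s]).
Hypothesis irr_s : 'Res[Y] 'chi_s \in irr Y.

Let nsYL : Y <| L.
Proof.
have [_ nNG] := andP nsNG.
by rewrite -defY /normal subsetIr normsI ?normG ?(subset_trans sLG).
Qed.

Let iGN : #|G : N| = #|L : Y|. Proof. by rewrite -defY (index_mulG defG). Qed.

(** Mackey's formula with a single double coset. By invariance both sides vanish off [N] and are the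
    common index times ['chi_s x] on it. *)
Lemma cfRes_Ind_supplement :
  'Res[L] ('Ind[G] 'chi_s) = 'Ind[L] ('Res[Y] 'chi_s).
Proof.
have [sNG nNG] := andP nsNG; have sYL := normal_sub nsYL.
have sYN: Y \subset N by rewrite -defY subsetIl.
apply/cfun_inP=> x Lx; have Gx := subsetP sLG x Lx.
rewrite cfResE // !cfIndE //.
have [Nx | notNx] := boolP (x \in N); last first.
  rewrite !big1 ?mulr0 // => y Hy; rewrite cfun0 //.
    apply: contra notNx; rewrite -defY => /setIP[Nxy _].
    by rewrite memJ_norm ?(subsetP nNG) ?(subsetP sLG) in Nxy.
  by rewrite memJ_norm ?(subsetP nNG).
have sumE (A : {group gT}) : A \subset G ->
    \sum_(y in A) 'chi_s (x ^ y)%g = #|A|%:R * 'chi_s x.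
  move=> sAG; rewrite mulr_natl -sumr_const; apply: eq_bigr => y Ay.
  by rewrite (inertia_valJ _ (subsetP IGs y _)) ?(subsetP sAG).
have ->: \sum_(y in L) 'Res[Y] 'chi_s (x ^ y)%g = #|L|%:R * 'chi_s x.
  rewrite -sumE //; apply: eq_bigr => y Ly; rewrite cfResE //.
  by rewrite -defY inE (groupJ Lx Ly) andbT memJ_norm ?(subsetP nNG) ?(subsetP
    sLG).
by rewrite sumE // !mulrA -!(mulrC _%:R) -!natf_indexg // iGN.
Qed.

Let cfnormInd : '['Ind[G] 'chi_s] = '['Res[L] ('Ind[G] 'chi_s)].
Proof.
have [t Dt] := irrP irr_s.
have IL: L \subset 'I['Res[Y] 'chi_s].
  have := sub_inertia_Res 'chi_s (normal_norm nsYL).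
  by rewrite (setIidPl (subset_trans sLG IGs)) subsetI subxx.
rewrite cfRes_Ind_supplement -!cfdot_Res_r !cfRes_Ind_invariant //.
by rewrite !cfdotZr cfnorm_irr Dt cfnorm_irr iGN.
Qed.

(* 'Ind[G] 'chi_s and its restriction to L have the same norm, which leaves   *)
(* no room for the restrictions of its constituents to split or to meet.      *)
Lemma cfdot_Res_supplement i j :
    i \in irr_constt ('Ind[G] 'chi_s) -> j \in irr_constt ('Ind[G] 'chi_s) ->
  '['Res[L] 'chi_i, 'Res[L] 'chi_j] = (i == j)%:R.
Proof.
move=> si sj; pose e k := '['Ind[G] 'chi_s, 'chi_k].
have e_ge0 k: 0 <= e k.
  by rewrite natr_ge0 // Cnat_cfdot_char_irr // cfInd_char ?irr_char.
have NR k: 'Res[L, G] 'chi_k \is a character by rewrite cfRes_char ?irr_char.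
(* [d] measures the failure of orthonormality and has nonnegative entries. Weighted by the
   multiplicities [e] it sums to a difference of equal norms, so it vanishes where both
   multiplicities are nonzero. *)
pose d i j := '['Res[L] 'chi[G]_i, 'Res[L] 'chi[G]_j] - (i == j)%:R.
have d_ge0 k l: 0 <= d k l.
  rewrite /d; have [<- | _] := eqVneq k l; last first.
    by rewrite subr0 natr_ge0 ?Cnat_cfdot_char.
  have [r /constt_charP[//|phi Nphi ->]] := neq0_has_constt (Res_irr_neq0 L k).
  rewrite subr_ge0 cfdotDl !cfdotDr cfnorm_irr -!addrA lerDl.
  by rewrite natr_ge0 // !rpredD ?Cnat_cfdot_char ?irr_char.
have: \sum_k \sum_l e k * e l * d k l = 0.
  have DF : 'Ind[G] 'chi_s = \sum_k e k *: 'chi_k by apply: cfun_sum_cfdot.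
  transitivity ('['Res[L] ('Ind[G] 'chi_s)] - '['Ind[G] 'chi_s]).
    have eC k: (e k)^* = e k by rewrite geC0_conj.
    rewrite DF linear_sum !cfdot_suml -sumrB; apply: eq_bigr => k _.
    rewrite !cfdot_sumr -sumrB; apply: eq_bigr => l _.
    rewrite !linearZ /= !cfdotZl !cfdotZr !eC cfdot_irr.
    rewrite -!mulrBr mulrA; reflexivity.
  by rewrite -cfnormInd subrr.
have t_ge0 k l: 0 <= e k * e l * d k l.
  exact: mulr_ge0 (mulr_ge0 (e_ge0 k) (e_ge0 l)) (d_ge0 k l).
move/eqP; rewrite psumr_eq0 => [|k _]; last by rewrite sumr_ge0.
move/allP/(_ i (mem_index_enum i)); rewrite psumr_eq0 //.
move/allP/(_ j (mem_index_enum j)); rewrite /= (mulf_eq0 (e i * e j)) (mulf_eq0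
  (e i)).
rewrite (negPf (si : e i != 0)) (negPf (sj : e j != 0)) /d subr_eq0.
by move/eqP.
Qed.

Lemma cfRes_supplement_irr i :
  i \in irr_constt ('Ind[G] 'chi_s) -> 'Res[L] 'chi_i \in irr L.
Proof.
by move=> si; rewrite irrEchar cfRes_char ?irr_char ?cfdot_Res_supplement ?eqxx.
Qed.

Lemma cfRes_supplement_onto k :
    k \in irr_constt ('Ind[L] ('Res[Y] 'chi_s)) ->
  exists2 i, i \in irr_constt ('Ind[G] 'chi_s) & 'Res[L] 'chi_i = 'chi_k.
Proof.
rewrite -cfRes_Ind_supplement [X in 'Res[L] X]cfun_sum_constt.
rewrite linear_sum irr_consttE cfdot_suml => sk.
have [i si ik]: exists2 i, i \in irr_constt ('Ind[G] 'chi_s)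
                         & '['Res[L] 'chi_i, 'chi_k] != 0.
  apply/exists_inP; apply: contraR sk; rewrite negb_exists_in => /forall_inP s0.
  apply/eqP; apply: big1 => i /s0; rewrite negbK linearZ cfdotZl => /eqP->.
  exact: mulr0.
exists i => //; have /irrP[l Dl] := cfRes_supplement_irr si.
by move: ik; rewrite Dl cfdot_irr; have [-> | _] := eqVneq l k; rewrite ?eqxx.
Qed.

Lemma lies_over_isometry (phi psi : 'CF(G)) :
    phi \is a character -> psi \is a character ->
    lies_over 'chi_s phi -> lies_over 'chi_s psi ->
  '['Res[L] phi, 'Res[L] psi] = '[phi, psi].
Proof.
have constt_s (chi : 'CF(G)) i : chi \is a character -> lies_over 'chi_s chi ->
    i \in irr_constt chi -> i \in irr_constt ('Ind[G] 'chi_s).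
  move=> Nchi over_s chi_i; rewrite constt_Ind_Res.
  exact/lies_over_irr_constt/(lies_over_constt Nchi).
move=> Nphi Npsi over_phi over_psi.
rewrite [phi]cfun_sum_constt [psi]cfun_sum_constt !linear_sum.
rewrite !cfdot_suml; apply: eq_bigr => i /(constt_s _ _ Nphi over_phi) si.
rewrite !cfdot_sumr; apply: eq_bigr => j /(constt_s _ _ Npsi over_psi) sj.
rewrite !linearZ !cfdotZl !cfdotZr cfdot_irr.
by rewrite cfdot_Res_supplement.
Qed.

End Supplement.

(** * pi-separable groups *)

Section PiSeparableGroups.

Variables (gT : finGroupType) (pi : nat_pred).
Implicit Types A B G H K L M N R X : {group gT}.

Lemma pi_factor_index G H K : pi_factor pi G H K =
  [&& H <| G, K <| G, H \subset K & pi.-nat #|K : H| || pi^'.-nat #|K : H|].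
Proof.
rewrite /pi_factor /pgroup; case: (boolP (H <| G)) => //= nsHG.
case: (boolP (K <| G)) => //= nsKG; rewrite card_quotient //.
exact: subset_trans (normal_sub nsKG) (normal_norm nsHG).
Qed.

Lemma pi_factorI G L A B : L \subset G ->
  pi_factor pi G A B -> pi_factor pi L (A :&: L) (B :&: L).
Proof.
move=> sLG; rewrite !pi_factor_index => /and4P[nsAG nsBG sAB piAB].
have nsIL C : C <| G -> C :&: L <| L.
  by case/andP=> _ nCG; rewrite /normal subsetIr normsI ?normG ?(subset_trans
    sLG).
rewrite !nsIL ?setSI //=; have [sBG [_ nAG]] := (normal_sub nsBG, andP nsAG).
have ->: #|B :&: L : A :&: L| = #|B :&: L : A|.
  by rewrite -[RHS]indexgI setIAC (setIidPr sAB).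
have dv: (#|B :&: L : A| %| #|B : A|)%N.
  rewrite -!card_quotient ?(subset_trans _ nAG) //; last first.
    by rewrite subIset ?sBG.
  by rewrite cardSg ?quotientS ?subsetIl.
by case/orP: piAB => /(pnat_dvd dv) ->; rewrite ?orbT.
Qed.

Lemma pi_separableS G L :
  L \subset G -> pi_separable pi G -> pi_separable pi L.
Proof.
move=> sLG [s ser_s last_s]; pose h B := (B :&: L)%G.
have h1: h 1%G = 1%G by apply/val_inj/setIidPl; rewrite sub1G.
exists (map h s); last first.
  by rewrite -h1 last_map last_s; apply/val_inj/setIidPr.
rewrite -{1}h1; move: ser_s; apply: homo_path => A B.
exact: pi_factorI.
Qed.

(** [R] joins [N] to the first term of the series outside [N]; the preceding term lies in [N], so
    the new index divides that of a factor of the series. *)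
Lemma normal_pi_step G N : pi_separable pi G -> N <| G -> N != G ->
  exists R, [/\ N \proper R, R <| G & pi.-nat #|R : N| \/ pi^'.-nat #|R : N|].
Proof.
case=> s ser_s last_s nsNG neNG.
have: ~~ (last 1%G s \subset N).
  by rewrite last_s; apply: contra neNG => sGN; rewrite -val_eqE eqEsubset sGN
    normal_sub.
have: 1%G \subset N by rewrite sub1G.
elim: s 1%G ser_s {last_s} => [|B s IHs] A /=; first by move=> _ ->.
case/andP; rewrite /= pi_factor_index => /and4P[nsAG nsBG sAB piAB] ser_s sAN.
have [sBN | not_sBN] := boolP (B \subset N); first exact: IHs.
move=> _; exists (N <*> B)%G; split.
- by rewrite properEneq joing_subl andbT; apply: contraNneq not_sBN => ->;
    rewrite joing_subr.
- by rewrite normalY.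
have nNB: B \subset 'N(N) := subset_trans (normal_sub nsBG) (normal_norm nsNG).
have ->: #|(N <*> B)%G : N| = #|B : N|.
  by rewrite -!card_quotient ?join_subG ?normG //= quotientYidl.
have dv: (#|B : N| %| #|B : A|)%N by apply: indexgS.
by case/orP: piAB => /(pnat_dvd dv) ->; [left | right].
Qed.

Lemma coprime_supplement_exists M N X :
    N <| M -> X <| M -> N \subset X -> coprime #|X : N| #|M : X| ->
  exists K, [/\ N \subset K, K \subset M, (X * K)%g = M & X :&: K = N].
Proof.
move=> nsNM nsXM sNX coXM; have [sNM nNM] := andP nsNM.
have sXM := normal_sub nsXM; have nNX := subset_trans sXM nNM.
have nsNX: N <| X by apply: normalS nsNM.
have hallX: Hall (M / N) (X / N).
  rewrite /Hall quotientS //= -divgS ?quotientS //= !card_quotient //.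
  by rewrite -(Lagrange_index sXM sNX) mulnK ?indexg_gt0 // coprime_sym.
have /splitsP[Kb /complP[tiXK defM]] := SchurZassenhaus_split hallX
  (quotient_normal N nsXM).
have sKM: Kb \subset (M / N)%g by rewrite -defM mulG_subr.
have [K defK sNK sKM'] := inv_quotientS nsNM sKM.
have nNK := subset_trans sKM' nNM.
exists K; split=> //.
  apply/eqP; rewrite eqEsubset mul_subG //= -{1}(mulSGid sNX) -mulgA.
  by rewrite -quotientSK // quotientMl // -defK defM.
apply/eqP; rewrite eqEsubset subsetI sNX sNK andbT.
rewrite -quotient_sub1 ?subIset ?nNX // quotientGI // -defK.
by rewrite tiXK subxx.
Qed.

(** Induction upwards from [N]: after a pi'-step [R], the subgroup found over [R] is replaced by a
    supplement of [R] in it that meets [R] in [N]. *)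
Lemma pi_Hall_over G N : pi_separable pi G -> N <| G ->
  exists H, [/\ N \subset H, H \subset G, pi.-nat #|H : N| & pi^'.-nat #|G :
    H|].
Proof.
move=> sepG; have [n] := ubnP #|G : N|.
elim: n N => // n IHn N /ltnSE-leGNn nsNG.
have [-> | neNG] := eqVneq N G; first by exists G; rewrite !indexgg.
have [R [/andP[sNR not_sRN] nsRG piRN]] := normal_pi_step sepG nsNG neNG.
have sRG := normal_sub nsRG.
have ltRN: (#|G : R| < #|G : N|)%N.
  rewrite -(Lagrange_index sRG sNR) ltn_Pmulr ?indexg_gt0 //.
  by rewrite indexg_gt1.
have [H1 [sRH1 sH1G piH1 pi'H1]] := IHn R (leq_trans ltRN leGNn) nsRG.
case: piRN => [piRN | pi'RN].
  exists H1; split; rewrite ?(subset_trans sNR) //.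
  by rewrite -(Lagrange_index sRH1 sNR) pnatM piH1.
have nsNH1 : N <| H1 by apply: normalS nsNG; rewrite ?(subset_trans sNR).
have nsRH1 : R <| H1 by apply: normalS nsRG.
have [|K [sNK sKH1 defH1 tiRK]] := coprime_supplement_exists nsNH1 nsRH1 sNR.
  by rewrite coprime_sym (pnat_coprime piH1).
exists K; split=> //; first exact: subset_trans sH1G.
  by rewrite -tiRK -(index_mulG defH1).
rewrite -(Lagrange_index sH1G sKH1) pnatM pi'H1 /=.
have defH1' : (K * R)%g = H1.
  by rewrite -defH1 normC // (subset_trans sKH1) ?normal_norm.
by rewrite (index_mulG defH1') setIC tiRK.
Qed.

Lemma pi_Hall_exists G : pi_separable pi G -> exists H, pi.-Hall(G) H.
Proof.
move=> sepG; have [H [_ sHG piH pi'H]] := pi_Hall_over sepG (normal1 G).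
by exists H; rewrite /pHall sHG pi'H /pgroup -indexg1 piH.
Qed.

(** Because of this, class functions that agree on the pi-elements of [L] agree on those of [G].
    Modulo [N], the supplement contains a complement of [X / N] in its product with the image of
    [<[g]>], and complements are conjugate under [X / N]. *)
Lemma pi_elt_conj_supplement G N X L g :
    N <| G -> X <| G -> N \subset X -> pi^'.-nat #|X : N| ->
    N \subset L -> (X * L)%g = G -> g \in G -> pi.-elt g ->
  exists2 x, x \in X & (g ^ x)%g \in L.
Proof.
move=> nsNG nsXG sNX pi'X sNL defG Gg pi_g; have [sNG nNG] := andP nsNG.
have [sXG nXG] := andP nsXG; have sLG: L \subset G by rewrite -defG mulG_subr.
have nNg := subsetP nNG g Gg; pose Xb := (X / N)%G; pose U := <[coset N g]>%G.
have nXU: U \subset 'N(Xb).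
  by rewrite cycle_subG (subsetP (quotient_norms N nXG)) ?mem_quotient.
have piU: pi.-group U by apply: morph_p_elt nNg pi_g.
have pi'Xb: pi^'.-group Xb by rewrite /pgroup card_quotient // (subset_trans
  sXG).
have coXU: coprime #|Xb| #|U| by rewrite coprime_sym (pnat_coprime piU).
pose D := (L / N :&: Xb <*> U)%G.
have sXUG: Xb <*> U \subset (G / N)%g.
  by rewrite join_subG quotientS //= cycle_subG mem_quotient.
have defXU: (Xb * D)%g = Xb <*> U.
  rewrite group_modl ?joing_subl //; apply/setIidPr.
  by rewrite -quotientMl ?(subset_trans sXG) // defG.
have nsXD: Xb :&: D <| D.
  rewrite /normal subsetIr normsI ?normG //.
  by rewrite (subset_trans (subsetIr _ _)) // join_subG normG.
have iXD: #|D : Xb :&: D| = #|U|.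
  rewrite -(index_mulG defXU) (index_mulG (esym (norm_joinEr nXU))).
  by rewrite coprime_TIg ?indexg1.
have hallXD: Hall D (Xb :&: D).
  rewrite /Hall subsetIr iXD (coprimeSg _ coXU) //; exact: subsetIl.
have /splitsP[C /complP[tiXC defD]] := SchurZassenhaus_split hallXD nsXD.
have sCD: C \subset D by rewrite -defD mulG_subr.
have cardC: #|U| = #|C|.
  by rewrite -iXD (index_mulG defD) tiXC indexg1.
have sCUX: C \subset U <*> Xb.
  by rewrite joingC (subset_trans sCD) // subsetIr.
(* Conjugacy rests on the solvability of the cyclic [U], as [X / N] may be nonsolvable. *)
have solU: solvable U by rewrite abelian_sol ?cycle_abelian.
have [y Xy defC] := SchurZassenhaus_trans_actsol solU nXU sCUX coXU cardC.
have [x nNx Xx Dy] := morphimP Xy; exists x => //.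
have nsNL: N <| L by apply: normalS nsNG.
have: (coset N g ^ y)%g \in (L / N)%g.
  have: (coset N g ^ y)%g \in C by rewrite defC memJ_conjg cycle_id.
  by move/(subsetP sCD)/setIP=> [].
rewrite Dy -morphJ // => LNgx; rewrite -(quotientGK nsNL).
by rewrite mem_morphpre ?groupJ.
Qed.

Lemma sol_of_no_supplement G N X :
    N <| G -> X <| G -> N \subset X ->
    (forall L, N \subset L -> L \subset G -> (X * L)%g = G -> L :=: G) ->
  solvable (X / N)%g.
Proof.
move=> nsNG nsXG sNX noL; have [sNG nNG] := andP nsNG.
have nsXGb := quotient_normal N nsXG; have sXG := normal_sub nsXG.
apply: nilpotent_sol; apply: nilpotentS (Fitting_nil (X / N)).
rewrite -{1}(Sylow_gen (X / N)) gen_subG; apply/bigcupsP=> P /SylowP[p _ sylP].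
apply: Fitting_max (pgroup_nil (pHall_pgroup sylP)).
have defG := Frattini_arg nsXGb sylP.
have [L defL sNL sLG] := inv_quotientS nsNG (subsetIl (G / N)%g 'N(P)).
have nPG: (G / N)%g \subset 'N(P).
  have <-: L :=: G; last by rewrite -defL subsetIr.
  apply: noL => //; apply/eqP; rewrite eqEsubset mul_subG //=.
  rewrite -{1}(mulSGid sNX) -mulgA -quotientSK // quotientMl ?(subset_trans
    sXG) //.
  by rewrite -defL defG.
by rewrite /normal (pHall_sub sylP) (subset_trans _ nPG) ?quotientS.
Qed.

(* If X has no proper supplement containing N, then X / N is nilpotent by the *)
(* Frattini argument, so its complements in M / N are conjugate under X and a *)
(* second Frattini argument makes them normal in G.                           *)
Lemma normal_complement_of_no_supplement G N X M :
    N <| G -> X <| G -> M <| G -> N \subset X -> X \subset M ->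
    coprime #|X : N| #|M : X| ->
    (forall L, N \subset L -> L \subset G -> (X * L)%g = G -> L :=: G) ->
  exists K, [/\ K <| G, N \subset K, K \subset M, (X * K)%g = M & X :&: K = N].
Proof.
move=> nsNG nsXG nsMG sNX sXM coXM noL; have [sNG nNG] := andP nsNG.
have solX := sol_of_no_supplement nsNG nsXG sNX noL.
have [sMG nMG] := andP nsMG; have [sXG nXG] := andP nsXG.
have nsNM : N <| M by apply: normalS nsNG; rewrite ?(subset_trans sNX).
have nsXM : X <| M by apply: normalS nsXG.
have [K [sNK sKM defM tiXK]] := coprime_supplement_exists nsNM nsXM sNX coXM.
exists K; split=> //; rewrite /normal (subset_trans sKM) //=.
have sKG := subset_trans sKM sMG.
have <-: 'N_G(K) = G; last exact: subsetIr.
apply: noL; rewrite ?subsetIl //.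
  by rewrite subsetI sNG (subset_trans sNK) ?normG.
apply/eqP; rewrite eqEsubset mul_subG ?subsetIl //=.
apply/subsetP=> g Gg; have nNg := subsetP nNG g Gg.
have nNX := subset_trans sXG nNG; have nNK := subset_trans sKG nNG.
have nXK: (K / N)%g \subset 'N((X / N)%g) by rewrite quotient_norms
  ?(subset_trans sKG).
have sKgM: (K :^ g / N)%g \subset ((X / N) * (K / N))%g.
  by rewrite -quotientMl // defM quotientS // -(normsP nMG g Gg) conjSg.
have coXK: coprime #|(X / N)%g| #|(K / N)%g|.
  by move: coXM; rewrite (index_mulG defM) tiXK !card_quotient.
have cardK: #|(K :^ g / N)%g| = #|(K / N)%g|.
  by rewrite quotientJ // cardJg.
have [y Xy] := SchurZassenhaus_trans_sol solX nXK sKgM coXK cardK.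
have [x nNx Xx ->] := morphimP Xy; rewrite -quotientJ // => eqK.
have Gx := subsetP sXG x Xx.
have {}eqK: K :^ g = K :^ x.
  have nsNJ z : z \in G -> N <| (K :^ z)%G.
    move=> Gz; rewrite -(normsP nNG z Gz) normalJ; apply: normalS nsNG => //.
  exact: (quotient_inj (nsNJ g Gg) (nsNJ x Gx) eqK).
have Ngx: (g * x^-1)%g \in 'N_G(K).
  by rewrite inE groupM ?groupV //=; apply/normP; rewrite conjsgM eqK conjsgK.
have nXN: 'N_G(K) \subset 'N(X) by rewrite subIset ?nXG.
by rewrite -(normC nXN) -[g](mulgKV x) mem_mulg.
Qed.

End PiSeparableGroups.

(** * Canonical extensions *)

Section DeterminantalOrder.

Variables (gT : finGroupType).
Implicit Types N G L : {group gT}.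

(** The power of [lambda] that is trivial on [N] is a linear character of [G / N]. *)
Lemma cforder_dvd_Res N G (lambda : 'CF(G)) :
    N <| G -> lambda \is a linear_char ->
  (#[lambda]%CF %| #['Res[N] lambda]%CF * #|G : N|)%N.
Proof.
move=> nsNG lin_l; set m := #['Res[N] lambda]%CF.
have lin_lm: lambda ^+ m \is a linear_char by rewrite rpredX.
have kerN: N \subset cfker (lambda ^+ m).
  rewrite -subsetIidl -cfker_Res ?lin_charW ?normal_sub //.
  by rewrite rmorphXn /= exp_cforder cfker_cfun1.
rewrite dvdn_cforder exprM -(cfQuoK nsNG kerN) -rmorphXn cfMod_eq1 //.
rewrite -dvdn_cforder -card_quotient ?normal_norm //.
by rewrite cforder_lin_char_dvdG ?cfQuo_lin_char.
Qed.

Lemma cfDet_order_Res N G (chi : 'CF(G)) : chi \is a character ->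
  ('o('Res[N] chi)%CF %| 'o(chi)%CF)%N.
Proof.
by move=> Nchi; rewrite /cfDet_order cfDetRes // cforder_rmorph.
Qed.

Lemma cfDet_order_lies_over N G s r :
    N <| G -> lies_over 'chi[N]_s 'chi[G]_r ->
  ('o('chi_r)%CF %| 'o('chi_s)%CF * #|G : N|)%N.
Proof.
move=> nsNG [c Dc].
apply: dvdn_trans (cforder_dvd_Res nsNG (cfDet_lin_char _)) _.
rewrite dvdn_mul // -cfDetRes ?irr_char // Dc.
have /natrP[e ->]: c \in Num.nat.
  have ->: c = '['Res[N] 'chi_r, 'chi_s].
    by rewrite Dc cfdotZl cfnorm_irr mulr1.
  by rewrite Cnat_cfdot_char_irr ?cfRes_char ?irr_char.
rewrite scaler_nat cfDetMn ?irr_char // dvdn_cforder -exprM mulnC exprM.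
by rewrite exp_cforder expr1n.
Qed.

End DeterminantalOrder.

Section PiControlled.

Variables (gT : finGroupType) (pi : nat_pred).
Implicit Types G H K L M N R X : {group gT}.

(* A weak form of pi-special, enough for extensions across pi'-factors and    *)
(* stable under them and under passing up a pi-factor.                        *)
Definition pi_controlled N (s : Iirr N) : Prop :=
  pi.-nat 'o('chi_s)%CF
  /\ (forall H, pi.-Hall(N) H -> 'Res[H] 'chi_s \in irr H).

(** The degree is that of an irreducible character of a Hall pi-subgroup, whose order it divides. *)
Lemma pi_controlled1 N s : pi_separable pi N -> pi_controlled s ->
  pi.-nat (Num.truncn ('chi[N]_s 1%g)).
Proof.
move=> /pi_Hall_exists[H hallH] [_ /(_ H hallH) /irrP[k Dk]].
apply: pnat_dvd (pHall_pgroup hallH).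
have := dvd_irr1_cardG k; rewrite -Dk cfRes1 -{1}(truncnK (Cnat_irr1 s)).
by rewrite dvdC_nat.
Qed.

Lemma pi_sub_of_pi'index N G H : N <| G -> pi^'.-nat #|G : N| ->
  H \subset G -> pi.-group H -> H \subset N.
Proof.
move=> /andP[_ nNG] pi'N sHG piH; have nNH := subset_trans sHG nNG.
rewrite -quotient_sub1 // subG1; apply/eqP/card1_trivg.
apply: (pnat_1 (quotient_pgroup N piH)); apply: pgroupS (quotientS N sHG) _.
by rewrite /pgroup card_quotient.
Qed.

(** A Hall pi-subgroup [H] of [M] supplements [N] and meets it in a Hall pi-subgroup, on which
    ['chi_s] stays irreducible; so [cfRes_supplement_irr] applies. *)
Lemma pi_controlled_up N M s r :
    N <| M -> pi.-nat #|M : N| -> M \subset 'I['chi[N]_s] ->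
    pi_controlled s -> lies_over 'chi_s 'chi[M]_r ->
  pi_controlled r.
Proof.
move=> nsNM piN IMs [os irr_s] over_r; split=> [|H hallH].
  by rewrite (pnat_dvd (cfDet_order_lies_over nsNM over_r)) // pnatM os.
have hallNH: pi.-Hall(N) (N :&: H) by rewrite setIC; apply: Hall_setI_normal
  hallH.
have defM: (N * H)%g = M.
  have [sHM _ pi'H] := and3P hallH.
  have sNM := normal_sub nsNM.
  by apply: coprime_index_mulG => //; rewrite (pnat_coprime piN).
apply: (cfRes_supplement_irr nsNM (pHall_sub hallH) defM (erefl _) IMs).
  exact: irr_s hallNH.
by rewrite constt_Ind_Res lies_over_irr_constt.
Qed.

Lemma pi_controlled_up' N X s r :
    N <| X -> pi^'.-nat #|X : N| -> pi_controlled s ->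
    'Res[N] 'chi[X]_r = 'chi_s -> pi.-nat 'o('chi_r)%CF ->
  pi_controlled r.
Proof.
move=> nsNX pi'N [_ irr_s] Dr or; split=> // H hallH.
have sHN: H \subset N.
  exact: pi_sub_of_pi'index pi'N (pHall_sub hallH) (pHall_pgroup hallH).
rewrite -(cfResRes _ sHN (normal_sub nsNX)) Dr irr_s //.
exact: pHall_subl sHN (normal_sub nsNX) hallH.
Qed.

Lemma pi_ext_exists N X s :
    pi_separable pi N -> N <| X -> pi^'.-nat #|X : N| ->
    X \subset 'I['chi[N]_s] -> pi_controlled s ->
  exists2 r, 'Res[N] 'chi[X]_r = 'chi_s /\ pi.-nat 'o('chi_r)%CF
    & forall r', 'Res[N] 'chi[X]_r' = 'chi_s -> pi.-nat 'o('chi_r')%CF -> r' =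
      r.
Proof.
move=> sepN nsNX pi'N IXs ctl_s; have co m: pi.-nat m -> coprime #|X : N| m.
  by move=> pi_m; rewrite coprime_sym (pnat_coprime pi_m).
have os := proj1 ctl_s.
have [r [Dr or uniq_r]] := coprime_irr_extendible nsNX IXs
  (co _ (pi_controlled1 sepN ctl_s)) (co _ os).
exists r; rewrite ?or // => r' Dr' or'.
by apply: uniq_r; rewrite ?co.
Qed.

(** A conjugate of ['chi_r] extends the same invariant character with the same determinantal order,
    so uniqueness identifies the two. *)
Lemma pi_ext_invariant G N X s r :
    pi_separable pi N -> N <| G -> X <| G -> N \subset X ->
    pi^'.-nat #|X : N| -> G \subset 'I['chi[N]_s] -> pi_controlled s ->
    'Res[N] 'chi[X]_r = 'chi_s -> pi.-nat 'o('chi_r)%CF ->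
  G \subset 'I['chi_r].
Proof.
move=> sepN nsNG nsXG sNX pi'N IGs ctl_s Dr or.
have nsNX: N <| X by apply: normalS sNX (normal_sub nsXG) nsNG.
have [|r0 _ uniq_r] := pi_ext_exists sepN nsNX pi'N _ ctl_s.
  exact: subset_trans (normal_sub nsXG) IGs.
apply/subsetP=> g Gg; rewrite inE (subsetP (normal_norm nsXG)) //=.
rewrite -conjg_IirrE; apply/eqP; congr 'chi_ _.
rewrite [RHS](uniq_r r) //; apply: uniq_r; rewrite conjg_IirrE.
  rewrite -(cfConjgRes (G := G)) // Dr.
  by rewrite inertiaJ ?(subsetP IGs).
rewrite /cfDet_order cfDetConjg cforder_inj_rmorph //.
exact: can_inj (cfConjgK g).
Qed.

End PiControlled.

(** * pi'-factors *)

Section LyingOverTheory.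

Variables (gT : finGroupType) (pi : nat_pred).
Implicit Types G H K L M N R X Y T : {group gT}.

Lemma lies_over_ind N G s (P : 'CF(G) -> Prop) :
    P 0 ->
    (forall i chi, lies_over 'chi[N]_s 'chi_i -> P chi -> P ('chi_i + chi)) ->
  forall chi, chi \is a character -> lies_over 'chi_s chi -> P chi.
Proof.
move=> P0 PD chi /char_sum_irr[r ->]; elim: r => [|i r IHr].
  by rewrite big_nil.
rewrite big_cons => over_ir.
have Nr: \sum_(j <- r) 'chi_j \is a character.
  by apply: rpred_sum => j _; apply: irr_char.
apply: PD; first by apply: lies_over_addl over_ir; rewrite ?irr_char.
by apply: IHr; apply: (@lies_over_addl _ _ _ _ _ 'chi_i); rewrite ?irr_char
  1?addrC.
Qed.

Lemma lies_over_trans N X G s t (chi : 'CF(G)) :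
    N \subset X -> X \subset G -> lies_over 'chi[N]_s 'chi[X]_t ->
  lies_over 'chi_t chi -> lies_over 'chi_s chi.
Proof.
move=> sNX sXG [a Da] [b Db]; exists (b * a).
by rewrite -(cfResRes _ sNX sXG) Db linearZ /= Da scalerA.
Qed.

Lemma lies_overD N G s (phi psi : 'CF(G)) :
  lies_over 'chi[N]_s phi -> lies_over 'chi_s psi -> lies_over 'chi_s (phi +
    psi).
Proof. by case=> a Da [b Db]; exists (a + b); rewrite linearD /= Da Db
  scalerDl. Qed.

Lemma lies_over0 N G s : lies_over 'chi[N]_s (0 : 'CF(G)).
Proof. by exists 0; rewrite linear0 scale0r. Qed.

Lemma lies_over_Res N L G s (chi : 'CF(G)) : N \subset L -> L \subset G ->
  lies_over 'chi[N]_s chi -> lies_over 'chi_s ('Res[L] chi).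
Proof. by move=> sNL sLG [c Dc]; exists c; rewrite cfResRes. Qed.

Lemma lies_over_Ind N T G s (chi : 'CF(T)) :
    N <| G -> N \subset T -> T \subset G -> G \subset 'I['chi[N]_s] ->
  lies_over 'chi_s chi -> lies_over 'chi_s ('Ind[G] chi).
Proof.
move=> nsNG sNT sTG IGs [c Dc]; have [sNG /subsetP nNG] := andP nsNG.
exists (#|T|%:R^-1 * (#|G|%:R * c)); apply/cfun_inP=> x Nx.
rewrite cfResE // cfunE cfIndE // -!mulrA; congr (_ * _).
rewrite mulr_natl -sumr_const; apply: eq_bigr => y Gy.
rewrite -(cfResE _ sNT) ?memJ_norm ?nNG // Dc cfunE.
by rewrite (inertia_valJ _ (subsetP IGs y Gy)).
Qed.

Lemma lies_over_supplement N G L Y s v (eta : 'CF(L)) :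
    N <| G -> L \subset G -> (N * L)%g = G -> N :&: L = Y ->
    G \subset 'I['chi_s] -> 'Res[Y] 'chi[N]_s = 'chi_v ->
    eta \is a character -> lies_over 'chi[Y]_v eta ->
  exists chi : 'CF(G),
    [/\ chi \is a character, lies_over 'chi_s chi & 'Res[L] chi = eta].
Proof.
move=> nsNG sLG defG defY IGs Dv; move: eta.
have irr_v: 'Res[Y] 'chi_s \in irr Y by rewrite Dv mem_irr.
apply: lies_over_ind => [|k eta over_k [chi [Nchi over_chi Dchi]]].
  by exists 0; split; rewrite ?rpred0 ?linear0 //; apply: lies_over0.
have [|i si Di] := cfRes_supplement_onto nsNG sLG defG defY IGs irr_v (k := k).
  by rewrite Dv constt_Ind_Res lies_over_irr_constt.
exists ('chi_i + chi); rewrite rpredD ?irr_char //; split=> //.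
  by apply: lies_overD => //; apply: lies_over_inv => //; rewrite
    -constt_Ind_Res.
by rewrite linearD /= Di Dchi.
Qed.

Lemma pi_restr_eqP G (chi psi : 'CF(G)) :
  pi_restr pi chi = pi_restr pi psi <-> {in G, forall x, pi.-elt x -> chi x =
    psi x}.
Proof.
split=> [eq_cp x Gx pi_x | eq_cp].
  by have := congr1 (fun f : 'CF(G) => f x) eq_cp; rewrite !pi_restrE pi_x.
apply/cfun_inP=> x Gx; rewrite !pi_restrE.
by case: ifP => // pi_x; rewrite eq_cp.
Qed.

Lemma pi_restrD G (chi psi : 'CF(G)) :
  pi_restr pi (chi + psi) = pi_restr pi chi + pi_restr pi psi.
Proof. exact: mulrDl. Qed.

Lemma pi_restr_Res G H (chi : 'CF(G)) : H \subset G ->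
  pi_restr pi ('Res[H] chi) = 'Res[H] (pi_restr pi chi).
Proof.
by move=> sHG; apply/cfun_inP=> x Hx; rewrite pi_restrE !cfResE // pi_restrE.
Qed.

(* By induction one may replace G by a supplement of X. If there is none, the *)
(* pi-factor above X splits as X K with K normal in G, and Clifford theory    *)
(* over K applies, the pi'-factor above K being isomorphic to X / N.          *)
Lemma pi_restr_over_extension G N X s t (chi : 'CF(G)) :
    pi_separable pi G -> N <| G -> X <| G -> N \subset X ->
    pi^'.-nat #|X : N| -> G \subset 'I['chi_s] -> pi_controlled pi s ->
    'Res[N] 'chi[X]_t = 'chi_s -> pi.-nat 'o('chi_t)%CF ->
    chi \is a character -> lies_over 'chi[N]_s chi ->
  exists chi' : 'CF(G), [/\ chi' \is a character, lies_over 'chi_t chi'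
                          & pi_restr pi chi' = pi_restr pi chi].
Proof.
(* This sum drops in each case: [R] for [X] lowers the second index, a proper supplement [L] lowers
   the first, and ([T], [K], [R]) for ([G], [N], [X]) lowers the second without raising the
   first. *)
have [n] := ubnP (#|G : N| + #|G : X|).
elim: n G N X s t chi => // n IHn G N X s t chi /ltnSE-leGn sepG nsNG nsXG sNX.
move=> pi'X IGs ctl_s Dt ot; move: chi.
apply: lies_over_ind => [|i chi over_i [chi' [Nchi' over_chi' Dchi']]].
  by exists 0; split; rewrite ?rpred0 //; apply: lies_over0.
suffices [psi [Npsi over_psi Dpsi]]: exists psi : 'CF(G),
    [/\ psi \is a character, lies_over 'chi_t psi
      & pi_restr pi psi = pi_restr pi 'chi_i].
  exists (psi + chi'); rewrite rpredD // !pi_restrD Dpsi Dchi'; split=> //.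
  exact: lies_overD.
have [sNG sXG] := (normal_sub nsNG, normal_sub nsXG).
have sepN := pi_separableS sNG sepG.
have nsNX : N <| X by apply: normalS sNX sXG nsNG.
have [eqXG | neXG] := eqVneq X G.
  move: over_i; subst X => -[c Dc].
  have /natrP[e De]: c \in Num.nat.
    have ->: c = '['Res[N] 'chi_i, 'chi_s].
      by rewrite Dc cfdotZl cfnorm_irr mulr1.
    by rewrite Cnat_cfdot_char_irr ?cfRes_char ?irr_char.
  (* All pi-elements of [G] lie in [N], where both characters are [c *: 'chi_s]. *)
  exists (c *: 'chi_t); split; first by rewrite De scaler_nat rpredMn ?irr_char.
    by exists c; rewrite cfRes_id.
  apply/pi_restr_eqP=> x Gx pi_x.
  have Nx: x \in N.
    rewrite -cycle_subG; apply: pi_sub_of_pi'index pi'X _ _ => //.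
    by rewrite cycle_subG.
  by rewrite cfunE -[in RHS](cfResE _ sNG Nx) Dc cfunE -Dt cfResE.
have [R [/andP[sXR not_sRX] nsRG piRX]] := normal_pi_step sepG nsXG neXG.
have sRG := normal_sub nsRG; have sNR := subset_trans sNX sXR.
have IXt := pi_ext_invariant sepN nsNG nsXG sNX pi'X IGs ctl_s Dt ot.
have ltRX: (#|G : R| < #|G : X|)%N.
  by rewrite -(Lagrange_index sRG sXR) ltn_Pmulr ?indexg_gt0 // indexg_gt1.
case: piRX => [piR | pi'R]; last first.
  (* [R / N] is again a pi'-group; the canonical extension [u] to [R] restricts to [t] by
     uniqueness. *)
  have pi'RN: pi^'.-nat #|R : N| by rewrite -(Lagrange_index sXR sNX) pnatM
    pi'R.
  have nsNR : N <| R by apply: normalS sNR sRG nsNG.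
  have [|u [Du ou] _] := pi_ext_exists sepN nsNR pi'RN _ ctl_s.
    exact: subset_trans IGs.
  have ltn' : (#|G : N| + #|G : R| < n)%N.
    by apply: leq_trans leGn; rewrite ltn_add2l.
  have [psi [Npsi over_psi Dpsi]] := IHn G N R s u 'chi_i ltn' sepG nsNG nsRG
    sNR pi'RN IGs ctl_s Du ou (irr_char i) over_i.
  exists psi; split=> //; apply: lies_over_trans over_psi => //.
  exists 1; rewrite scale1r.
  have DRN : 'Res[N] ('Res[X] 'chi_u) = 'chi_s by rewrite cfResRes.
  have /irrP[t' Dt']: 'Res[X] 'chi_u \in irr X.
    apply: (cfRes_irr_irr (H := N)); first by rewrite cfRes_char ?irr_char.
    by rewrite DRN mem_irr.
  have [|r _ uniq_r] := pi_ext_exists sepN nsNX pi'X _ ctl_s.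
    exact: subset_trans IGs.
  rewrite Dt' in DRN *; congr 'chi_ _; rewrite [RHS](uniq_r t) //.
  apply: uniq_r => //; rewrite -Dt'.
  by apply: pnat_dvd ou; apply: cfDet_order_Res; apply: irr_char.
have coXR : coprime #|X : N| #|R : X|.
  by rewrite coprime_sym (pnat_coprime piR).
have [/existsP[L /and4P[sNL sLG /eqP defG neLG]] | noL] := boolP
    [exists L : {group gT}, [&& N \subset L, L \subset G, (X * L)%g == G & L !=
      G]].
  pose Y := (X :&: L)%G.
  have sNY: N \subset Y by rewrite subsetI sNX.
  have sYX: Y \subset X := subsetIl _ _.
  have nsYL : Y <| L by rewrite /normal subsetIr normsI ?normG ?(subset_trans
    sLG (normal_norm nsXG)).
  have [v Dv]: exists v, 'Res[Y] 'chi_t = 'chi_v.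
    apply/irrP; apply: (cfRes_irr_irr (H := N)); first by rewrite cfRes_char
      ?irr_char.
    by rewrite cfResRes // Dt mem_irr.
  have DvN: 'Res[N] 'chi_v = 'chi_s by rewrite -Dv cfResRes.
  have ov: pi.-nat 'o('chi_v)%CF.
    by rewrite -Dv; apply: pnat_dvd ot; apply: cfDet_order_Res; apply: irr_char.
  have ltLG: (#|L : N| + #|L : Y| < n)%N.
    apply: leq_trans leGn; rewrite -(index_mulG defG) ltn_add2r.
    rewrite -(Lagrange_index sLG sNL) ltn_Pmull ?indexg_gt0 // indexg_gt1.
    by apply: contra neLG => sGL; rewrite -val_eqE eqEsubset sLG.
  have [||||eta [Neta over_eta Deta]] := IHn L N Y s v ('Res[L] 'chi_i) ltLG
    (pi_separableS sLG sepG) (normalS sNL sLG nsNG) nsYL sNY _ _ ctl_s DvN ov.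
  - by apply: pnat_dvd pi'X; apply: indexSg.
  - exact: subset_trans IGs.
  - by rewrite cfRes_char ?irr_char.
  - exact: lies_over_Res.
  (* The character found on [L] lifts back to [G] constituent by constituent; pi-elements are
     conjugate into [L], so agreement there suffices. *)
  have [psi [Npsi over_psi Dpsi]] := lies_over_supplement nsXG sLG defG (erefl
    _)
    IXt Dv Neta over_eta.
  exists psi; split=> //; apply/pi_restr_eqP=> x Gx pi_x.
  have [y Xy Lxy] := pi_elt_conj_supplement nsNG nsXG sNX pi'X sNL defG Gx pi_x.
  have Gy := subsetP sXG y Xy.
  rewrite -(cfunJ _ _ Gy) -(cfunJ 'chi_i _ Gy) -!(cfResE _ sLG Lxy) Dpsi.
  by move/pi_restr_eqP: Deta => ->; rewrite ?p_eltJ.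
have [|K [nsKG sNK sKR defR tiXK]] :=
    normal_complement_of_no_supplement nsNG nsXG nsRG sNX sXR coXR.
  move=> L sNL sLG defG; apply/eqP/idPn=> neLG; case/existsP: noL; exists L.
  by rewrite sNL sLG defG eqxx.
have sKG := normal_sub nsKG.
have iKN: #|K : N| = #|R : X| by rewrite (index_mulG defR) tiXK.
have defR': (K * X)%g = R.
  by rewrite -defR normC // (subset_trans sKG) ?normal_norm.
have iRK: #|R : K| = #|X : N| by rewrite (index_mulG defR') setIC tiXK.
have nsNK : N <| K by apply: normalS sNK sKG nsNG.
have [k ik] := constt_cfRes_irr K i.
have over_k: lies_over 'chi_s 'chi_k.
  apply: lies_over_constt ik; first by rewrite cfRes_char ?irr_char.
  exact: lies_over_Res.
have ctl_k: pi_controlled pi k.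
  apply: (pi_controlled_up nsNK) over_k => //; first by rewrite iKN.
  exact: subset_trans IGs.
have nsXR : X <| R by apply: normalS sXR sRG nsXG.
have irr_t : 'Res[N] 'chi_t \in irr N by rewrite Dt mem_irr.
have IRt : R \subset 'I['chi_t] := subset_trans sRG IXt.
(* [K] supplements [X] in [R] and [t] stays irreducible on [N], so [k] extends to some [m] over [t].
   Its determinantal order is a pi-number, and its existence puts [R] inside the inertia group [T]
   of [k]. *)
have [|m tm Dm] := cfRes_supplement_onto nsXR sKR defR tiXK IRt irr_t (k := k).
  by rewrite Dt constt_Ind_Res lies_over_irr_constt.
have over_m: lies_over 'chi_t 'chi_m.
  by apply: lies_over_inv => //; rewrite -constt_Ind_Res.
have om: pi.-nat 'o('chi_m)%CF.
  by rewrite (pnat_dvd (cfDet_order_lies_over nsXR over_m)) // pnatM ot.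
have nsKR : K <| R by apply: normalS sKR sRG nsKG.
pose T := 'I_G['chi_k]%G; have sTG: T \subset G := subsetIl _ _.
have sRT: R \subset T.
  rewrite subsetI sRG; apply/subsetP=> x Rx.
  rewrite inE (subsetP (normal_norm nsKR)) //= -Dm.
  by rewrite (cfConjgRes _ (normal_refl R) nsKR Rx) cfConjg_id.
have sKT := subset_trans sKR sRT; have sXT := subset_trans sXR sRT.
have nsKT : K <| T := normalS sKT sTG nsKG.
have [_ _ imT _ _] := constt_Inertia_bijection k nsKG.
have: i \in irr_constt ('Ind[G] 'chi_k) by rewrite constt_Ind_Res.
rewrite -imT => /imsetP[j Tj Dij].
have [irrT _ _ _ _] := constt_Inertia_bijection k nsKG.
have {Dij}Di: 'chi_i = 'Ind[G] 'chi_j by rewrite Dij cfIirrE ?irrT.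
have over_j: lies_over 'chi_k 'chi_j.
  by apply: lies_over_inv; rewrite ?subsetIr // -constt_Ind_Res.
have ltT: (#|T : K| + #|T : R| < n)%N.
  apply: leq_trans leGn; apply: leq_trans (_ : #|G : K| + #|G : R| < _)%N.
    by rewrite ltnS leq_add // dvdn_leq ?indexSg.
  rewrite -addnS leq_add // -(Lagrange_index sKG sNK) leq_pmulr ?indexg_gt0 //.
have [||eta [Neta over_eta Deta]] := IHn T K R k m 'chi_j ltT
    (pi_separableS sTG sepG) nsKT (normalS sRT sTG nsRG) sKR _ _ ctl_k Dm om
    (irr_char j) over_j.
- by rewrite iRK.
- exact: subsetIr.
exists ('Ind[G] eta); split; first exact: cfInd_char.
  by apply: lies_over_Ind => //; apply: lies_over_trans over_eta.
by rewrite -pi_Ind_restr // Deta Di pi_Ind_restr.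
Qed.

End LyingOverTheory.

(** * pi-factors and inducing pairs *)

Section PartialCharacters.

Variables (gT : finGroupType) (pi : nat_pred).
Implicit Types G H L M N T W X Y : {group gT}.

Lemma lies_over_Res_inj N G L Y s (phi psi : 'CF(G)) :
    N <| G -> L \subset G -> (N * L)%g = G -> N :&: L = Y ->
    G \subset 'I['chi[N]_s] -> 'Res[Y] 'chi_s \in irr Y ->
    phi \is a character -> psi \is a character ->
    lies_over 'chi_s phi -> lies_over 'chi_s psi ->
  'Res[L] phi = 'Res[L] psi -> phi = psi.
Proof.
move=> nsNG sLG defG defY IGs irr_s Nphi Npsi over_phi over_psi eqL.
have iso := lies_over_isometry nsNG sLG defG defY IGs irr_s.
apply/eqP; rewrite -subr_eq0 -cfnorm_eq0 cfnormB.
by rewrite -!iso // eqL -cfnormB subrr cfdot0l.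
Qed.

Lemma lies_over_ortho M G r (A B : 'CF(G)) :
    M \subset G -> A \is a character -> lies_over 'chi[M]_r A ->
    B \is a character -> '['Res[M] B, 'chi_r] = 0 ->
  '[A, B] = 0.
Proof.
move=> sMG NA over_A NB BM0; move: A NA over_A.
apply: lies_over_ind => [|i A over_i A0]; first exact: cfdot0l.
rewrite cfdotDl A0 addr0 cfdotC; apply/eqP; rewrite conjC_eq0.
apply: contraLR (lies_over_irr_constt over_i) => iB.
apply/negP=> ri; have := constt_Res_trans NB iB ri.
by rewrite irr_consttE BM0 eqxx.
Qed.

Lemma lies_over_split N M G s r (xi : 'CF(G)) :
    M <| G -> G \subset 'I['chi[M]_r] -> xi \is a character ->
    lies_over 'chi[N]_s xi ->
  exists a b : 'CF(G), [/\ xi = a + b, a \is a character, b \is a character,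
    lies_over 'chi_r a /\ lies_over 'chi_s b & '['Res[M] b, 'chi_r] = 0].
Proof.
move=> nsMG IGr; move: xi.
apply: lies_over_ind => [|i xi over_i [a [b [-> Na Nb [over_a over_b] b0]]]].
  exists 0, 0; rewrite rpred0 addr0 linear0 cfdot0l; split=> //.
  by split; apply: lies_over0.
have [ri | not_ri] := boolP (r \in irr_constt ('Res[M] 'chi_i)).
  exists ('chi_i + a), b; rewrite addrA rpredD ?irr_char //; split=> //.
  by split=> //; apply: lies_overD => //; apply: lies_over_inv.
exists a, ('chi_i + b); rewrite addrCA rpredD ?irr_char //; split=> //.
  by split=> //; apply: lies_overD.
by move: not_ri; rewrite irr_consttE negbK linearD cfdotDl b0 addr0 => /eqP.
Qed.

(* Restricting to U = M<x> and then to a Hall pi-subgroup of U, where         *)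
(* restriction is an isometry, turns this into ordinary orthogonality on U.   *)
Lemma pi_restr_isotypic N M W s r (A1 A2 B1 B2 : 'CF(W)) :
    pi_separable pi W -> N <| W -> M <| W -> N \subset M -> pi.-nat #|M : N| ->
    W \subset 'I['chi[N]_s] -> pi_controlled pi s ->
    lies_over 'chi_s 'chi[M]_r ->
    A1 \is a character -> A2 \is a character ->
    B1 \is a character -> B2 \is a character ->
    lies_over 'chi_r A1 -> lies_over 'chi_r A2 ->
    lies_over 'chi_s B1 -> lies_over 'chi_s B2 ->
    '['Res[M] B1, 'chi_r] = 0 -> '['Res[M] B2, 'chi_r] = 0 ->
    pi_restr pi (A1 + B1) = pi_restr pi (A2 + B2) ->
  pi_restr pi A1 = pi_restr pi A2.
Proof.
move=> sepW nsNW nsMW sNM piMN IWs [_ irr_s] over_r NA1 NA2 NB1 NB2.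
move=> over_A1 over_A2 over_B1 over_B2 B10 B20 /pi_restr_eqP eqAB.
apply/pi_restr_eqP=> x Wx pi_x.
have [sMW nMW] := andP nsMW; have nMx := subsetP nMW x Wx.
pose U := (M <*> <[x]>)%G; have sUW: U \subset W by rewrite join_subG sMW
  cycle_subG.
have sMU: M \subset U := joing_subl _ _; have sNU := subset_trans sNM sMU.
have Ux: x \in U by rewrite mem_gen // inE cycle_id orbT.
have nsNU : N <| U := normalS sNU sUW nsNW.
have piUN: pi.-nat #|U : N|.
  rewrite -(Lagrange_index sMU sNM) pnatM piMN andbT.
  rewrite -card_quotient ?(subset_trans sUW) // quotientYidl ?cycle_subG //.
  by apply: quotient_pgroup.
have [H hallH] := pi_Hall_exists (pi_separableS sUW sepW).
have [sHU piH pi'H] := and3P hallH.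
have defU: (N * H)%g = U.
  by apply: coprime_index_mulG; rewrite // (pnat_coprime piUN).
have hallNH: pi.-Hall(N) (N :&: H) by rewrite setIC; apply: Hall_setI_normal
  hallH.
have IUs := subset_trans sUW IWs.
have over_s (A : 'CF(W)) : lies_over 'chi_r A -> lies_over 'chi_s A.
  by apply: lies_over_trans.
have RU (A : 'CF(W)) : lies_over 'chi_s A -> lies_over 'chi_s ('Res[U] A).
  by apply: lies_over_Res.
have RUr (A : 'CF(W)) : lies_over 'chi_r A -> lies_over 'chi_r ('Res[U] A).
  by apply: lies_over_Res.
have eqU: 'Res[U] (A1 + B1) = 'Res[U] (A2 + B2).
  apply: (lies_over_Res_inj nsNU sHU defU (erefl _) IUs (irr_s _ hallNH)).
  - by rewrite cfRes_char ?rpredD.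
  - by rewrite cfRes_char ?rpredD.
  - by apply: RU; apply: lies_overD => //; apply: over_s.
  - by apply: RU; apply: lies_overD => //; apply: over_s.
  rewrite !cfResRes //; apply/cfun_inP=> h Hh.
  have Wh := subsetP sUW h (subsetP sHU h Hh).
  by rewrite !cfResE ?(subset_trans sHU) // eqAB // (mem_p_elt piH).
have ortho (A B : 'CF(W)) : A \is a character -> B \is a character ->
    lies_over 'chi_r A -> '['Res[M] B, 'chi_r] = 0 -> '['Res[U] A, 'Res[U] B] =
      0.
  move=> NA NB over_A B0; apply: (lies_over_ortho sMU) (RUr A over_A) _ _.
  - exact: cfRes_char.
  - exact: cfRes_char.
  - by rewrite cfResRes.
have{eqU}: 'Res[U] A1 - 'Res[U] A2 = 'Res[U] B2 - 'Res[U] B1.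
  apply/eqP; rewrite subr_eq addrAC eq_sym subr_eq eq_sym.
  by rewrite -!linearD /= eqU addrC.
move=> eqU; suffices: 'Res[U] A1 - 'Res[U] A2 == 0.
  by rewrite subr_eq0 => /eqP eqA; rewrite -(cfResE A1 sUW Ux) eqA cfResE.
(* The difference on the [A] side equals one on the orthogonal [B] side, so its norm is 0. *)
by rewrite -cfnorm_eq0 {2}eqU cfdotBl !cfdotBr !ortho // !subrr.
Qed.

(** A constituent with nonzero remainder would split the pi-partial character. *)
Lemma pi_partial_irr_irr G (chi : 'CF(G)) :
  chi \is a character -> pi_partial_irr pi (pi_restr pi chi) -> chi \in irr G.
Proof.
move=> Nchi [[chi0 /andP[Nchi0 nz_chi0] Dchi0] irr_chi].
have nz_chi: chi != 0.
  apply: contraNneq nz_chi0 => chi_0; rewrite -char1_eq0 //.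
  have := congr1 (fun f : 'CF(G) => f 1%g) Dchi0.
  by rewrite /= !pi_restrE p_elt1 chi_0 cfunE => <-.
have [i chi_i] := neq0_has_constt nz_chi.
have [chi' Nchi' Dchi] := constt_charP i Nchi chi_i.
have [chi'0 | nz_chi'] := eqVneq chi' 0; first by rewrite Dchi chi'0 addr0
  mem_irr.
case: irr_chi; exists (pi_restr pi 'chi_i), (pi_restr pi chi').
split; last by rewrite -pi_restrD -Dchi.
  by exists 'chi_i; rewrite // irr_char irr_neq0.
by exists chi'; rewrite // Nchi' nz_chi'.
Qed.

(** A splitting on [T] would induce to a splitting on [G]. *)
Lemma pi_partial_irr_Ind T G (chi : 'CF(T)) :
    T \subset G -> chi \is a character ->
    pi_partial_irr pi (pi_restr pi ('Ind[G] chi)) ->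
  pi_partial_irr pi (pi_restr pi chi).
Proof.
move=> sTG Nchi irr_chi; have [_ indec] := irr_chi.
have IndN := pi_partial_irr_irr (cfInd_char G Nchi) irr_chi.
have nz_chi: chi != 0.
  by apply: contraTneq IndN => ->; rewrite linear0 irrEchar cfdot0l eq_sym
    oner_eq0 andbF.
split; first by exists chi; rewrite ?Nchi.
case=> a [b [[ca /andP[Nca nz_ca] ->] [cb /andP[Ncb nz_cb] ->] Dab]].
case: indec; exists (pi_restr pi ('Ind[G] ca)), (pi_restr pi ('Ind[G] cb));
  split.
- by exists ('Ind[G] ca); rewrite // cfInd_char ?cfInd_eq0.
- by exists ('Ind[G] cb); rewrite // cfInd_char ?cfInd_eq0.
by rewrite -!pi_Ind_restr // Dab /pi_Ind linearD.
Qed.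

(** The climb, by induction on [#|G : N|]. In the last clause [xi], possibly zero, ranges only over
    characters above ['chi_s], so that it can be adapted to the next term of the series. *)
Lemma pi_partial_inducing_pair G N s (chi : 'CF(G)) :
    pi_separable pi G -> N <| G -> G \subset 'I['chi[N]_s] ->
    pi_controlled pi s -> chi \is a character -> lies_over 'chi_s chi ->
    pi_partial_irr pi (pi_restr pi chi) ->
  exists (W : {group gT}) (gamma : 'CF(W)),
    [/\ N \subset W /\ W \subset G, gamma \is a character /\ lies_over 'chi_s
      gamma,
        pi_restr pi ('Ind[G] gamma) = pi_restr pi chi,
        pi.-nat (Num.truncn (gamma 1%g))
      & forall xi, xi \is a character -> lies_over 'chi_s xi ->
          pi_restr pi ('Res[W] chi) <> pi_restr pi (gamma *+ 2 + xi)].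
Proof.
have [n] := ubnP #|G : N|.
elim: n G N s chi => // n IHn G N s chi /ltnSE-leGn sepG nsNG IGs ctl_s Nchi.
move=> over_chi irr_chi; have [sNG nNG] := andP nsNG.
have /irrP[i Di] := pi_partial_irr_irr Nchi irr_chi.
subst chi; clear Nchi.
have [eqNG | neNG] := eqVneq N G.
  subst N; exists G, 'chi_i.
  have := lies_over_irr_constt over_chi; rewrite cfRes_id constt_irr => /eqP
    Dsi.
  rewrite Dsi in ctl_s over_chi *.
  split; rewrite ?irr_char ?cfInd_id ?(pi_controlled1 sepG ctl_s) //.
  (* Here [gamma] is the lift itself, and degrees exclude multiplicity two. *)
  move=> xi Nxi _ /pi_restr_eqP/(_ 1%g (group1 G) (p_elt1 _ _)).
  rewrite mulr2n !cfunE => /eqP; rewrite -addrA -subr_eq0 opprD addNKr.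
  rewrite oppr_eq0 paddr_eq0 ?char1_ge0 ?irr_char //.
  by rewrite (negPf (irr1_neq0 i)).
have [R [/andP[sNR not_sRN] nsRG piRN]] := normal_pi_step sepG nsNG neNG.
have sRG := normal_sub nsRG; have nsNR : N <| R := normalS sNR sRG nsNG.
have sepN := pi_separableS sNG sepG.
have ltn : (#|G : R| < n)%N.
  apply: leq_trans leGn; rewrite -(Lagrange_index sRG sNR).
  by rewrite ltn_Pmulr ?indexg_gt0 // indexg_gt1.
case: piRN => [piR | pi'R]; last first.
  have [|t [Dt ot] _] := pi_ext_exists sepN nsNR pi'R _ ctl_s.
    exact: subset_trans IGs.
  have [chi' [Nchi' over_chi' Dchi']] := pi_restr_over_extension sepG nsNG nsRG
    sNR pi'R IGs ctl_s Dt ot (irr_char i) over_chi.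
  have IGt := pi_ext_invariant sepN nsNG nsRG sNR pi'R IGs ctl_s Dt ot.
  have ctl_t := pi_controlled_up' nsNR pi'R ctl_s Dt ot.
  rewrite -Dchi' in irr_chi.
  have [W [gamma [[sRW sWG] [Ng over_g] Dg pi_g M1]]] :=
    IHn G R t chi' ltn sepG nsRG IGt ctl_t Nchi' over_chi' irr_chi.
  have over_t: lies_over 'chi_s 'chi_t by exists 1; rewrite scale1r.
  have sNW := subset_trans sNR sRW.
  exists W, gamma; split; rewrite ?Dg //.
    by split=> //; apply: lies_over_trans over_g.
  move=> xi Nxi over_xi Dxi.
  (* The remainder [xi] is exchanged for one over [t] with the same values on pi-elements. *)
  have [|xi' [Nxi' over_xi' Dxi']] := pi_restr_over_extension
      (pi_separableS sWG sepG) (normalS sNW sWG nsNG) (normalS sRW sWG nsRG)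
      sNR pi'R _ ctl_s Dt ot Nxi over_xi.
    exact: subset_trans IGs.
  case: (M1 xi' Nxi' over_xi').
  rewrite pi_restr_Res // Dchi' -pi_restr_Res // Dxi.
  by rewrite !pi_restrD Dxi'.
have [r ir] := constt_cfRes_irr R i.
have over_r: lies_over 'chi_s 'chi_r.
  apply: lies_over_constt ir; first by rewrite cfRes_char ?irr_char.
  exact: lies_over_Res.
have ctl_r: pi_controlled pi r.
  by apply: (pi_controlled_up nsNR) over_r => //; apply: subset_trans IGs.
pose T := 'I_G['chi_r]%G; have sTG: T \subset G := subsetIl _ _.
have sRT: R \subset T := sub_Inertia 'chi_r sRG.
have nsRT : R <| T := normalS sRT sTG nsRG.
have [irrT _ imT _ eq_mul] := constt_Inertia_bijection r nsRG.
have: i \in irr_constt ('Ind[G] 'chi_r) by rewrite constt_Ind_Res.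
rewrite -imT => /imsetP[j Tj Dij].
have {Dij}Di: 'chi_i = 'Ind[G] 'chi_j by rewrite Dij cfIirrE ?irrT.
have over_j: lies_over 'chi_r 'chi_j.
  by apply: lies_over_inv; rewrite ?subsetIr // -constt_Ind_Res.
have irr_j: pi_partial_irr pi (pi_restr pi 'chi_j).
  by apply: (pi_partial_irr_Ind sTG); rewrite ?irr_char -?Di.
have ltTn: (#|T : R| < n)%N by apply: leq_ltn_trans ltn; rewrite dvdn_leq
  ?indexSg.
have [W [gamma [[sRW sWT] [Ng over_g] Dg pi_g M1]]] :=
  IHn T R r 'chi_j ltTn (pi_separableS sTG sepG) nsRT (subsetIr _ _) ctl_r
    (irr_char j) over_j irr_j.
have sWG := subset_trans sWT sTG; have sNW := subset_trans sNR sRW.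
have nsNW : N <| W := normalS sNW sWG nsNG.
have nsRW : R <| W := normalS sRW sWG nsRG.
exists W, gamma; split=> //.
- by split=> //; apply: lies_over_trans over_g.
- rewrite -(cfIndInd _ sTG sWT) -pi_Ind_restr // Dg.
  by rewrite pi_Ind_restr // -Di.
move=> xi Nxi over_xi Dxi.
have IWr: W \subset 'I['chi_r] := subset_trans sWT (subsetIr _ _).
(* The remainder [xi] need not lie over [r], so only its part [a] over [r] is kept. Likewise
   ['chi_j] carries the full multiplicity of [r] in ['chi_i], so [rho] avoids [r]. Comparing the
   parts over [r] on pi-elements contradicts the multiplicity clause for [T]. *)
have [a [b [Dab Na Nb [over_a over_b] b0]]] := lies_over_split nsRW IWr Nxi
  over_xi.
have ij: j \in irr_constt ('Res[T] 'chi_i).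
  by rewrite -constt_Ind_Res -Di constt_irr inE.
have [rho Nrho Drho] := constt_charP j (cfRes_char T (irr_char i)) ij.
have rho0: '['Res[R] rho, 'chi_r] = 0.
  have /= := eq_mul j Tj; rewrite -Di -(cfResRes _ sRT sTG) Drho linearD
    cfdotDl.
  by move/eqP; rewrite -subr_eq0 opprD addNKr oppr_eq0 => /eqP.
have over_rho: lies_over 'chi_s rho.
  apply: (@lies_over_addl _ _ _ _ _ 'chi_j); rewrite ?irr_char //.
  by rewrite addrC -Drho; apply: lies_over_Res => //; apply: subset_trans sRT.
case: (M1 a Na over_a).
apply: (pi_restr_isotypic (pi_separableS sWG sepG) nsNW nsRW sNR piR _ ctl_s
  over_r _ _ _ Nb _ _ _ over_b _ b0 (B1 := 'Res[W] rho)).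
- exact: subset_trans IGs.
- by rewrite cfRes_char ?irr_char.
- by rewrite rpredD ?rpredMn.
- by rewrite cfRes_char.
- exact: lies_over_Res.
- by apply: lies_overD => //; rewrite mulr2n; apply: lies_overD.
- by apply: lies_over_Res => //; apply: subset_trans sRT.
- by rewrite cfResRes.
by rewrite -linearD /= -Drho cfResRes // Dxi Dab addrA.
Qed.

End PartialCharacters.

(** * Twists by linear characters of pi'-order *)

Section LinearTwists.

Variables (gT : finGroupType) (pi : nat_pred).
Implicit Types G V W : {group gT}.

(** [V] is the preimage of the pi-core of the abelianization of [W], which is a Hall pi-subgroup
    there. *)
Lemma max_abelian_pi'_quotient W :
  exists V : {group gT}, [/\ V <| W, abelian (W / V)%g
                          & #|W : V| = (#|W : W^`(1)|`_pi^')%N].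
Proof.
have nsDW: W^`(1) <| W := der_normal 1 W.
have abWD: abelian (W / W^`(1))%g := sub_der1_abelian (subxx _).
have hallO := nilpotent_pcore_Hall pi (abelian_nil abWD).
have [V defV sDV nsVW] := inv_quotientN nsDW (pcore_normal pi (W / W^`(1))%g).
exists V; split; rewrite ?sub_der1_abelian //.
have sVW := normal_sub nsVW.
have <-: #|(W / W^`(1))%g| = #|W : W^`(1)| by rewrite card_quotient
  ?normal_norm.
apply/eqP; rewrite -(eqn_pmul2l (cardG_gt0 'O_pi((W / W^`(1))%g)%G)).
rewrite {2}(card_Hall hallO) partnC // /= defV.
have nDW := normal_norm nsDW.
by rewrite !card_quotient ?(subset_trans sVW) // mulnC Lagrange_index.
Qed.

(** Taking determinants multiplies that of [gamma] by the m-th power of the linear character, [m]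
    being the degree; and [m] is invertible modulo [q], which kills all linear characters of
    [W / V]. *)
Lemma lin_twist_inj V W (gamma : 'CF(W)) (j k : Iirr (W / V)) :
    V <| W -> abelian (W / V)%g -> gamma \is a character ->
    coprime #|W : V| (Num.truncn (gamma 1%g)) ->
    ('chi_j %% V)%CF * gamma = ('chi_k %% V)%CF * gamma ->
  j = k.
Proof.
move=> nsVW abWV Ng co_m eq_jk; apply: irr_inj.
have lin l : 'chi[W / V]_l \is a linear_char by apply/char_abelianP.
set m := Num.truncn _ in co_m; set q := #|W : V| in co_m.
have chi_q l : 'chi[W / V]_l ^+ q = 1.
  apply/eqP; rewrite -dvdn_cforder /q -card_quotient ?normal_norm //.
  exact: cforder_lin_char_dvdG.
have eq_m: 'chi_j ^+ m = 'chi_k ^+ m.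
  have := congr1 (@cfDet _ _) eq_jk; rewrite !cfDet_mul_lin ?cfMod_lin_char //.
  move/(mulIr (lin_char_unitr (cfDet_lin_char gamma))).
  by rewrite -!rmorphXn; apply: (can_inj (cfModK nsVW)).
have [b bm_q]: exists b, b * m = 1 %[mod q].
  rewrite -(chinese_modl co_m 1 0) /chinese !mul0n addn0 !mul1n mulnC.
  by exists (egcdn m q).1.
have chi_bm l : 'chi[W / V]_l = ('chi_l ^+ m) ^+ b.
  by rewrite -exprM mulnC -(expr_mod _ (chi_q l)) bm_q expr_mod ?chi_q.
by rewrite (chi_bm j) eq_m -chi_bm.
Qed.

Lemma pi_restr_lin_twist V W (gamma : 'CF(W)) (j : Iirr (W / V)) :
    V <| W -> abelian (W / V)%g -> pi^'.-nat #|W : V| ->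
  pi_restr pi (('chi_j %% V)%CF * gamma) = pi_restr pi gamma.
Proof.
move=> nsVW abWV pi'V; apply/pi_restr_eqP=> x Wx pi_x.
have lin_j: 'chi_j \is a linear_char by apply/char_abelianP.
have Vx: x \in V.
  rewrite -cycle_subG; apply: pi_sub_of_pi'index pi'V _ _ => //.
  by rewrite cycle_subG.
rewrite cfunE cfker1 ?(subsetP (cfker_mod _ nsVW)) // cfMod1.
by rewrite lin_char1 ?mul1r.
Qed.

End LinearTwists.

Theorem theorem1p1 (gT : finGroupType) (pi : nat_pred) (G : {group gT})
    (phi : 'CF(G)) :
  pi_separable pi G -> pi_partial_irr pi phi ->
  exists W : {group gT}, exists alpha : 'CF(W),
    [/\ W \subset G,
        pi_partial_irr pi alpha,
        (#|lifts pi phi| >= #|W : W^`(1)|`_(pi^'))%N,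
        pi_Ind G alpha = phi
      & exists2 n : nat, pi.-nat n & alpha 1%g = n%:R].
Proof.
move=> sepG irr_phi; have [[chi /andP[Nchi _] Dphi] _] := irr_phi.
(* With trivial [N] lying over is no condition, so the climb can start and [M1] will apply to every
   character [xi]. *)
have over1 (H : {group gT}) (xi : 'CF(H)) : lies_over 'chi[[1 gT]]_0 xi.
  exists (xi 1%g); apply/cfun_inP=> _ /set1P->.
  by rewrite cfRes1 cfunE irr0 cfun11 mulr1.
have ctl1: pi_controlled pi (0 : Iirr [1 gT]).
  split=> [|H hallH]; rewrite irr0.
    apply: (@pnat_dvd _ 1%N) => //.
    by rewrite cfDet_order_lin ?cfun1_lin_char // dvdn_cforder expr1n.
  by rewrite rmorph1 -irr0 mem_irr.
have IG1: G \subset 'I['chi[[1 gT]]_0] by rewrite irr0 inertia1 norms1.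
have irr_chi: pi_partial_irr pi (pi_restr pi chi) by rewrite -Dphi.
have [W [gamma [[_ sWG] [Ng _] Dg pi_g M1]]] :=
  pi_partial_inducing_pair sepG (normal1 G) IG1 ctl1 Nchi (over1 G chi) irr_chi.
have irr_g: pi_partial_irr pi (pi_restr pi gamma).
  by apply: (pi_partial_irr_Ind sWG); rewrite ?Dg.
exists W, (pi_restr pi gamma); split=> //; last first.
- exists (Num.truncn (gamma 1%g)) => //.
  by rewrite pi_restrE p_elt1 truncnK // Cnat_char1.
- by rewrite pi_Ind_restr // Dg Dphi.
have [V [nsVW abWV iWV]] := max_abelian_pi'_quotient pi W.
have pi'V: pi^'.-nat #|W : V| by rewrite iWV part_pnat.
rewrite -iWV -card_quotient ?normal_norm // -(card_Iirr_abelian abWV).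
pose twist (j : Iirr (W / V)) := ('chi_j %% V)%CF * gamma.
have irrW := pi_partial_irr_irr Ng irr_g.
have irr_twist j: twist j \in irr W.
  by rewrite mul_lin_irr // cfMod_lin_char //; apply/char_abelianP.
have Ntwist j: twist j \is a character by rewrite irrWchar.
have restr_Ind j: pi_restr pi ('Ind[G] (twist j)) = phi.
  by rewrite -pi_Ind_restr // pi_restr_lin_twist // pi_Ind_restr // Dg.
have irr_Ind j: 'Ind[G] (twist j) \in irr G.
  by apply: (@pi_partial_irr_irr _ pi); rewrite ?cfInd_char ?restr_Ind.
pose f j := cfIirr ('Ind[G] (twist j)).
have Df j: 'chi_(f j) = 'Ind[G] (twist j) by rewrite cfIirrE.
suffices inj_f: injective f.
  rewrite -(card_imset predT inj_f); apply: subset_leq_card.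
  by apply/subsetP=> _ /imsetP[j _ ->]; rewrite inE Df restr_Ind.
move=> j k eq_f; apply/eqP/idPn => ne_jk.
have ne_twist: twist j != twist k.
  apply: contraNneq ne_jk => /lin_twist_inj-> //.
  by rewrite coprime_sym (pnat_coprime pi_g).
set chi' := 'chi_(f j).
(* By Frobenius reciprocity each twist inducing to [chi'] occurs in its restriction to [W], so two
   distinct ones can both be split off. *)
have twist_res l: f l = f j -> '['Res[W] chi', twist l] = 1.
  move=> eq_l; rewrite cfdot_Res_l -Df eq_l cfnorm_irr //.
have NR: 'Res[W] chi' \is a character by rewrite cfRes_char ?irr_char.
have /irrP[a Da] := irr_twist j; have /irrP[b Db] := irr_twist k.
have aR: a \in irr_constt ('Res[W] chi').
  by rewrite irr_consttE -Da twist_res ?oner_neq0.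
have [rho Nrho Drho] := constt_charP a NR aR.
have bR: b \in irr_constt rho.
  have := twist_res k (esym eq_f); rewrite Drho Db cfdotDl cfdot_irr.
  rewrite -(inj_eq irr_inj) -Da -Db (negPf ne_twist) add0r => rho_b.
  by rewrite irr_consttE -Db rho_b oner_neq0.
have [xi Nxi Dxi] := constt_charP b Nrho bR.
case: (M1 xi Nxi (over1 _ xi)).
rewrite pi_restr_Res // -Dphi -(restr_Ind j) -pi_restr_Res // -Df -/chi' Drho
  Dxi.
by rewrite -Da -Db mulr2n !pi_restrD !pi_restr_lin_twist // addrA.
Qed.
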